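(* Let $G$ be a connected graph containing none of the bull, the chair, or $C_5$ as an induced subgraph. Then at least one of the following holds: (i) $G$ contains $\overline{C}_7\oplus K_1$; (ii) $G$ contains $C_{2i+1}\oplus K_2$ for some $i\geq1$; (iii) $G$ contains $M_{3i+1}\oplus K_1$ for some $i\geq 1$; (iv) for some $i\geq 1$, $G$ contains a clique expansion $C_{2i+1}[k_1,\ldots,k_{2i+1}]$ of one of the following two forms: $(k_1,\ldots,k_{2i+1})=(2,2,\ldots,2,1,3,1,3,\ldots,3,1)$, i.e. an even number $a\geq 0$ of entries equal to $2$ followed by an alternating sequence $1,3,1,3,\ldots,3,1$ beginning and ending with $1$; or $(k_1,\ldots,k_{2i+1})=(2,2,\ldots,2,1)$; (v) $G$ is $4$-colorable.
   Context: A bull is the graph with vertices $v_1,\ldots,v_5$ and edges $v_1v_2,v_2v_3,v_3v_4,v_4v_5,v_2v_4$. A chair is the graph obtained from the claw $K_{1,3}$ by subdividing one edge once (vertices $c,a,b,d,e$ with edges $ca,cb,cd,de$). ''$G$ contains $H$'' means $G$ has a (not necessarily induced) subgraph isomorphic to $H$. $\overline{C}_7$ is the complement of the $7$-cycle. $G\oplus H$ denotes the join of $G$ and $H$: disjoint union plus all edges between $V(G)$ and $V(H)$. For $p\geq 1$, the spindle graph $M_{3p+1}$ is a graph of order $3p+1$ containing a cycle $u_0u_1\ldots u_{3p}u_0$ such that, for each $i\in\{1,\ldots,p\}$ (indices modulo $3p+1$), $N(u_{3i})=\{u_{3i-2},u_{3i-1},u_{3i+1},u_{3i+2}\}$ and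 $N(u_{3i-1})\cap N(u_{3i-2})=\{u_{3i-3},u_{3i}\}$ ($M_4\cong K_4$, $M_7$ is the Moser spindle). For $p\geq 3$ and positive integers $k_1,\ldots,k_p$, the clique expansion $C_p[k_1,\ldots,k_p]$ replaces vertex $v_i$ of the cycle $v_1\ldots v_p$ by a clique of size $k_i$, with complete adjacency between cliques of cyclically consecutive vertices and no edges between other distinct cliques.
   Formalization: The condition N(u_{3i})={u_{3i-2},u_{3i-1},u_{3i+1},u_{3i+2}} is imposed only for i<p when p≥2; for i=p it would add an edge u_{3p}u_1, contradicting that M_7 is the Moser spindle and making the theorem false (M_10⊕K_1). *)

(* Defs.v *)
From mathcomp Require Import all_boot.

Set Implicit Arguments.
Unset Strict Implicit.
Unset Printing Implicit Defensive.

Record sgraph := SGraph {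
  svertex :> finType;
  sadj : rel svertex;
  sadj_sym : symmetric sadj;
  sadj_irr : irreflexive sadj
}.

Notation "x -- y" := (sadj x y) (at level 30, no associativity).

Section GraphOf.
Variables (T : finType) (r : rel T).

Definition symm_loopless : rel T := fun x y => (x != y) && (r x y || r y x).

Lemma symm_loopless_sym : symmetric symm_loopless.
Proof. by move=> x y; rewrite /symm_loopless eq_sym orbC. Qed.

Lemma symm_loopless_irr : irreflexive symm_loopless.
Proof. by move=> x; rewrite /symm_loopless eqxx. Qed.

Definition graph_of : sgraph := SGraph symm_loopless_sym symm_loopless_irr.

End GraphOf.

Definition graph_of_edges (n : nat) (s : seq (nat * nat)) : sgraph :=
  graph_of (fun i j : 'I_n => (val i, val j) \in s).

Definition contains (G H : sgraph) : Prop :=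
  exists f : H -> G, injective f /\ forall x y : H, x -- y -> f x -- f y.

Definition contains_induced (G H : sgraph) : Prop :=
  exists f : H -> G, injective f /\ forall x y : H, (f x -- f y) = (x -- y).

Definition connected (G : sgraph) : Prop :=
  forall x y : G, connect (@sadj G) x y.

Definition colorable (k : nat) (G : sgraph) : Prop :=
  exists c : G -> 'I_k, forall x y : G, x -- y -> c x != c y.

Definition complete (n : nat) : sgraph := graph_of (fun _ _ : 'I_n => true).

(* [ordS] is the cyclic successor; this is the n-cycle only for 3 <= n. *)
Definition cycle_graph (n : nat) : sgraph := graph_of (fun i j : 'I_n => j == ordS i).

Definition compl (G : sgraph) : sgraph := graph_of (fun x y : G => ~~ x -- y).

Definition join (G H : sgraph) : sgraph :=
  graph_of (fun u v : G + H =>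
    match u, v with
    | inl x, inl y => x -- y
    | inr x, inr y => x -- y
    | inl _, inr _ => true
    | inr _, inl _ => true
    end).

(* Vertices v1, ..., v5 are numbered 0, ..., 4. *)
Definition bull : sgraph :=
  graph_of_edges 5 [:: (0, 1); (1, 2); (2, 3); (3, 4); (1, 3)].

(* Vertices c, a, b, d, e are numbered 0, ..., 4. *)
Definition chair : sgraph :=
  graph_of_edges 5 [:: (0, 1); (0, 2); (0, 3); (3, 4)].

(* The spindle M_(3p+1): the cycle u_0 ... u_(3p) together with, for each
   q < p, the two chords that turn u_(3q), ..., u_(3q+3) into a diamond. Thus
   N(u_(3i)) = {u_(3i-2), u_(3i-1), u_(3i+1), u_(3i+2)} for 1 <= i < p, and
   N(u_(3i-1)) and N(u_(3i-2)) meet in {u_(3i-3), u_(3i)} for 1 <= i <= p.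
   For i = p > 1, N(u_(3p)) = {u_(3p-2), u_(3p-1), u_0}: reading
   u_(3p+2) = u_1 as a further neighbour would add an edge that M_7, the
   Moser spindle, does not have. *)
Definition spindle (p : nat) : sgraph :=
  graph_of (fun u v : 'I_(3 * p).+1 =>
    (v == ordS u) ||
    [exists q : 'I_p,
      ((val u == 3 * q) && (val v == 3 * q + 2)) ||
      ((val u == 3 * q + 1) && (val v == 3 * q + 3))]).

(* C_p[k_1, ..., k_p] with ks = [:: k_1; ...; k_p] and p = size ks >= 3; a
   vertex is a pair of a position i on the cycle and a member of the clique
   that replaces it. *)
Definition clique_expansion (ks : seq nat) : sgraph :=
  graph_of (fun u v : {i : 'I_(size ks) & 'I_(nth 0 ks i)} =>
    (tag u == tag v) || (tag v == ordS (tag u))).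

(* 1, 3, 1, 3, ..., 3, 1 with m entries equal to 3. *)
Definition alternating13 (m : nat) : seq nat := 1 :: flatten (nseq m [:: 3; 1]).

(* The case m = 0 is [twos_then_one]. *)
Definition twos_then_alternating (ks : seq nat) : Prop :=
  exists a m : nat, [/\ ~~ odd a, 0 < m & ks = nseq a 2 ++ alternating13 m].

Definition twos_then_one (i : nat) (ks : seq nat) : Prop :=
  ks = rcons (nseq (2 * i) 2) 1.

(* Main.v *)
Require Import Defs.
From mathcomp Require Import all_boot zify.
From Stdlib Require Import Classical.

(* Consider a vertex-minimal graph that is not 4-colorable. A vertex outside an
   odd hole of length at least 7 sees nothing of it, all of it, or exactly three
   consecutive vertices. Hence the hole grows into a clique expansion A of an
   odd cycle C_(2t+1), complete to the set B of the vertices that see all of the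
   hole, and without edges to the remaining vertices. If two consecutive cliques
   of A never have more than q vertices together, then A is q-colorable as soon
   as it has at most qt vertices; otherwise nearly all consecutive cliques have
   exactly q vertices together, which gives the patterns of (iv) for q = 4 and a
   spindle for q = 3, to be joined with a vertex of B.
   An antihole of length 7 leaves finitely many ways to attach two more
   vertices, one of length 9 contains C_5[2,2,2,2,1], a longer one K_5.
   Without odd holes and odd antiholes the graph is perfect. Indeed a minimal
   imperfect graph has no star cutset and a connected complement. For an edge
   ve, the non-neighbours of v, layered by their distance from the neighbours of
   e, then form a chain of cliques, consecutive ones being completely joined.
   This forces stability number at most 2, bipartiteness, or a vertex of degree
   at most 2, and none of these occurs in a minimal imperfect graph. *)

Set Implicit Arguments.
Unset Strict Implicit.
Unset Printing Implicit Defensive.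

(** Perfection of Berge graphs is needed only inside this class, so the strong perfect graph theorem
    is replaced by a structural dichotomy and elementary recoloring. The pentagon is
    self-complementary: excluding it settles length 5 for holes and antiholes alike, and 7 is the
    first odd length left on either side. From there on six consecutive hole vertices induce a path,
    on which the analysis of an attached vertex relies. The two values of q come from B. If B is
    empty, A may use all four colors; otherwise B, which is stable unless (ii) holds, takes one
    color and leaves three to A. The bound qt is what q color classes can cover, as a stable set
    meets at most t of the 2t+1 cliques, each in one vertex. Twice the number of vertices of A plus
    the total shortfall of consecutive pairs below q equals q(2t+1), so beyond qt vertices the
    shortfall is at most q - 2; the places of these few units are the parameters of the patterns in
    (iv). *)

Definition bull_free (G : sgraph) := forall a b c p q : G,
  a -- b -> a -- c -> b -- c -> p -- a -> q -- b ->
  ~~ p -- b -> ~~ p -- c -> ~~ q -- a -> ~~ q -- c -> ~~ p -- q -> False.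

(** The leaves [a] and [b] are twins, so their distinctness has to be required; all other vertices
    are told apart by their adjacencies. *)
Definition chair_free (G : sgraph) := forall c a b d e : G,
  c -- a -> c -- b -> c -- d -> d -- e -> a != b ->
  ~~ a -- b -> ~~ a -- d -> ~~ b -- d ->
  ~~ e -- c -> ~~ e -- a -> ~~ e -- b -> False.

Definition pentagon_free (G : sgraph) := forall a b c d e : G,
  a -- b -> b -- c -> c -- d -> d -- e -> e -- a ->
  ~~ a -- c -> ~~ a -- d -> ~~ b -- d -> ~~ b -- e -> ~~ c -- e -> False.

(* [G] has no star cutset: no set made of [v] and some neighbours of [v] separates [b] from [u]. *)
Definition star_connected (G : sgraph) := forall (v : G) (B : {set G}) b u,
  b \in B -> v \notin B -> u \notin B -> u != v ->
  (forall s t, t \in B -> s \notin B -> s != v -> s -- t -> s -- v) ->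
  (forall t, t \in B -> ~~ u -- t) -> False.

Definition coconnected (G : sgraph) := forall (X : {set G}) x y,
  x \in X -> y \notin X ->
  (forall a b, a \in X -> b \notin X -> a -- b) -> False.

Ltac adj := first [ assumption | by rewrite sadj_sym; assumption
  | by rewrite eq_sym; assumption ].

(** * Graphs without star cutset *)

Section Dichotomy.
Variable G : sgraph.
Hypotheses (bullF : bull_free G) (chairF : chair_free G) (c5F : pentagon_free G).
Hypotheses (starC : star_connected G) (coC : coconnected G).
Implicit Types (a b c u v w x y z f : G).

Lemma neq_adj u v w : u -- w -> ~~ v -- w -> u != v.
Proof. by move=> uw; apply: contraNneq => <-. Qed.

Lemma adj_neq u v : u -- v -> u != v.
Proof. by apply: contraTneq => ->; rewrite sadj_irr. Qed.

(** An outside vertex that sees a member of [X] also sees [x]. So [x] and its neighbours outside [X]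
    form a star that separates the rest of [X] from [u]. *)
Lemma no_module (X : {set G}) x x' u :
  x \in X -> x' \in X -> x != x' -> u \notin X ->
  (forall s t t', s \notin X -> t \in X -> t' \in X -> s -- t -> s -- t') ->
  (forall t, t \in X -> ~~ u -- t) -> False.
Proof.
move=> xX x'X nxx' uX mX uN.
apply: (@starC x (X :\ x) x' u); rewrite ?inE ?eqxx //.
- by rewrite eq_sym nxx'.
- by rewrite negb_and uX orbT.
- by apply: contraNneq uX => ->.
- move=> s t; rewrite !inE => /andP[_ tX]; rewrite negb_and negbK => /orP[/eqP-> /eqP//|sX _ st].
  exact: (mX s t x).
- by move=> t /setD1P[_]; apply: uN.
Qed.

(** If [f] and [f'] are adjacent, the triangle [w f f'] with the pendant vertices [v] and [g] is a
    bull; if not, [w] is the centre of a chair with long leg [f], [g]. *)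
Lemma far_not_mixed v w f f' g : w -- v -> f -- w -> f' -- w -> f' != v ->
  ~~ f -- v -> ~~ f' -- v -> ~~ g -- v -> ~~ g -- w -> g -- f -> g -- f'.
Proof.
move=> wv fw f'w f'v fv f'v' gv gw gf; apply: contraT => gf'.
have [ff'|ff'] := boolP (f -- f').
  by case: (bullF (a:=w) (b:=f) (c:=f') (p:=v) (q:=g)); adj.
by case: (chairF (c:=w) (a:=v) (b:=f') (d:=f) (e:=g)); adj.
Qed.

Section Layers.
Variables v e : G.
Hypothesis ev : e -- v.

(* The non-neighbours of [v], by their distance 0, 1, 2, >= 3 from the
   neighbours of [e] among them. *)
Definition nearL := [set m | [&& m != v, ~~ m -- v & m -- e]].
Definition farL := [set m | [&& m != v, ~~ m -- v & ~~ m -- e]].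
Definition layer1 := [set m in farL | [exists f in nearL, m -- f]].
Definition layer2 := [set m in farL | (m \notin layer1) && [exists x in layer1, m -- x]].
Definition layer3 := [set m in farL | (m \notin layer1) && (m \notin layer2)].
Local Notation F := nearL.
Local Notation L1 := layer1.
Local Notation L2 := layer2.
Local Notation Z := layer3.

Lemma nearP f : f \in F -> [/\ f != v, ~~ f -- v & f -- e].
Proof. by rewrite inE => /and3P. Qed.

Lemma farP f : f \in farL -> [/\ f != v, ~~ f -- v & ~~ f -- e].
Proof. by rewrite inE => /and3P. Qed.

Lemma layer1E x : x \in L1 -> [/\ x != v, ~~ x -- v & ~~ x -- e].
Proof. by rewrite inE => /andP[/farP]. Qed.
Lemma layer2E x : x \in L2 -> [/\ x != v, ~~ x -- v & ~~ x -- e].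
Proof. by rewrite inE => /andP[/farP]. Qed.
Lemma layer3E x : x \in Z -> [/\ x != v, ~~ x -- v & ~~ x -- e].
Proof. by rewrite inE => /andP[/farP]. Qed.

Lemma layer1_near x f : x \in L1 -> f \in F -> x -- f.
Proof.
rewrite inE => /andP[/farP[xv xv' xe] /exists_inP[f0 /nearP[f0v f0v' f0e] xf0]] /nearP[fv fv' fe].
exact: (far_not_mixed ev f0e).
Qed.

Lemma notlayer1_near m f : m \in farL -> m \notin L1 -> f \in F -> ~~ m -- f.
Proof.
move=> mE mL fF; apply: contra mL => mf; rewrite inE mE; apply/exists_inP.
by exists f.
Qed.

Lemma layer2_far m : m \in L2 -> m \in farL. Proof. by rewrite inE => /andP[]. Qed.
Lemma layer2_notlayer1 m : m \in L2 -> m \notin L1. Proof. by rewrite inE => /and3P[]. Qed.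
Lemma layer3_far m : m \in Z -> m \in farL. Proof. by rewrite inE => /andP[]. Qed.
Lemma layer3_notlayer1 m : m \in Z -> m \notin L1. Proof. by rewrite inE => /and3P[]. Qed.
Lemma layer3_notlayer2 m : m \in Z -> m \notin L2. Proof. by rewrite inE => /and3P[]. Qed.

Lemma layer2_near y f : y \in L2 -> f \in F -> ~~ y -- f.
Proof. by move=> yL; apply: notlayer1_near; [exact: layer2_far | exact: layer2_notlayer1]. Qed.

Lemma layer3_near y f : y \in Z -> f \in F -> ~~ y -- f.
Proof. by move=> yL; apply: notlayer1_near; [exact: layer3_far | exact: layer3_notlayer1]. Qed.

Lemma layer3_layer1 z x : z \in Z -> x \in L1 -> ~~ z -- x.
Proof.
move=> zZ xL; apply: contra (layer3_notlayer2 zZ) => zx; rewrite inE (layer3_far zZ) (layer3_notlayer1 zZ).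
by apply/exists_inP; exists x.
Qed.

Lemma layer1_near_ex x : x \in L1 -> exists f, f \in F.
Proof. by rewrite inE => /andP[_ /exists_inP[f fF _]]; exists f. Qed.

Lemma layer1_clique x x' : x \in L1 -> x' \in L1 -> x != x' -> x -- x'.
Proof.
move=> xL x'L nx; apply: contraT => xx'.
have [f fF] := layer1_near_ex xL; have [_ fv fe] := nearP fF.
have [_ _ xe] := layer1E xL; have [_ _ x'e] := layer1E x'L.
have xf := layer1_near xL fF; have x'f := layer1_near x'L fF.
have [_ xv _] := layer1E xL; have [_ x'v _] := layer1E x'L.
by case: (chairF (c:=f) (a:=x) (b:=x') (d:=e) (e:=v)); adj.
Qed.

Lemma layer2_layer1_ex y : y \in L2 -> exists2 x, x \in L1 & y -- x.
Proof. by rewrite inE => /and3P[_ _ /exists_inP]. Qed.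

Lemma layer2_layer1 y x : y \in L2 -> x \in L1 -> y -- x.
Proof.
move=> yL x'L; have [x0 xL yx] := layer2_layer1_ex yL.
have [->//|nx] := eqVneq x x0.
apply: contraT => yx'.
have [f fF] := layer1_near_ex xL; have [_ fv fe] := nearP fF.
have yf := layer2_near yL fF.
have [_ _ xe] := layer1E xL; have [_ _ x'e] := layer1E x'L; have [_ _ ye] := layer2E yL.
have xf := layer1_near xL fF; have x'f := layer1_near x'L fF.
have xx' : x -- x0 by apply: layer1_clique.
by case: (bullF (a:=f) (b:=x0) (c:=x) (p:=e) (q:=y)); adj.
Qed.

Lemma layer2_clique y y' : y \in L2 -> y' \in L2 -> y != y' -> y -- y'.
Proof.
move=> yL y'L ny; apply: contraT => yy'; have [x xL yx] := layer2_layer1_ex yL.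
have y'x := layer2_layer1 y'L xL.
have [f fF] := layer1_near_ex xL; have [_ fv fe] := nearP fF.
have [_ _ xe] := layer1E xL; have [_ _ ye] := layer2E yL; have [_ _ y'e] := layer2E y'L.
have xf := layer1_near xL fF; have yf := layer2_near yL fF; have y'f := layer2_near y'L fF.
by case: (chairF (c:=x) (a:=y) (b:=y') (d:=f) (e:=e)); adj.
Qed.

Lemma layer3_layer2 z y y' : z \in Z -> y \in L2 -> y' \in L2 -> z -- y -> z -- y'.
Proof.
move=> zZ yL y'L zy; have [<-//|ny] := eqVneq y y'.
apply: contraT => zy'; have [x xL yx] := layer2_layer1_ex yL.
have y'x := layer2_layer1 y'L xL; have yy' := layer2_clique yL y'L ny.
have [f fF] := layer1_near_ex xL.
have xf := layer1_near xL fF; have yf := layer2_near yL fF; have y'f := layer2_near y'L fF.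
have zf := layer3_near zZ fF; have zx := layer3_layer1 zZ xL.
by case: (bullF (a:=x) (b:=y) (c:=y') (p:=f) (q:=z)); adj.
Qed.

(* Otherwise [B] would be separated from [u] by a star cutset centred at [v]. *)
Lemma far_connected (B : {set G}) b u : b \in B -> u \notin B -> u != v -> ~~ u -- v ->
  (forall t, t \in B -> t != v /\ ~~ t -- v) ->
  (forall s t, t \in B -> s \notin B -> s != v -> ~~ s -- v -> ~~ s -- t) -> False.
Proof.
move=> bB uB uv uv' Bv cl; apply: (starC (v:=v) bB _ uB uv).
- by apply/negP => /Bv[]; rewrite eqxx.
- by move=> s t tB sB sv st; apply: contraTT st => sv'; apply: cl.
- by move=> t tB; apply: cl.
Qed.

(** Otherwise every neighbour of [e] is [v] or sees [v], and a star centred at [v] cuts [e] off from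
    [m]. *)
Lemma near_ex m : m != v -> ~~ m -- v -> exists f, f \in F.
Proof.
move=> mv mv'; have [/existsP[f fF]|] := boolP [exists f, f \in F]; first by exists f.
rewrite negb_exists => /forallP nF; case: (starC (v:=v) (B:=[set e]) (b:=e) (u:=m)) => //.
- by rewrite inE.
- by rewrite inE; apply: contraTneq ev => ->; rewrite sadj_irr.
- by rewrite inE; apply: contraNneq mv' => ->.
- move=> s t; rewrite !inE => /eqP-> se sv st; apply: contraT => sv'.
  by have := nF s; rewrite inE sv sv' st.
- move=> t; rewrite inE => /eqP->; apply: contraT; rewrite negbK => me.
  by have := nF m; rewrite inE mv mv' me.
Qed.

Lemma mem_far m : m != v -> ~~ m -- v -> [|| m \in F, m \in L1, m \in L2 | m \in Z].
Proof.
move=> mv mv'; have [//|nF] := boolP (m \in F).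
have mE : m \in farL.
  by rewrite inE mv mv'; apply: contra nF => me; rewrite inE mv mv' me.
by rewrite [m \in Z]inE mE; case: (m \in L1); case: (m \in L2).
Qed.

(** Otherwise all edges leaving layer 3 end in neighbours of [v], and a star centred at [v]
    separates it from [F]. *)
Lemma layer3_ex_layer2 z : z \in Z -> exists2 z', z' \in Z & exists2 y, y \in L2 & z' -- y.
Proof.
move=> zZ; apply: NNPP => nz.
have [zv zv' ze] := layer3E zZ; have [f fF] := near_ex zv zv'; have [fv fv' fe] := nearP fF.
apply: (far_connected zZ (u:=f)) => //.
- by apply/negP => /layer3E[_ _]; rewrite fe.
- by move=> t /layer3E[].
- move=> s t tZ sZ sv sv'; rewrite sadj_sym; have := mem_far sv sv'.
  case/or4P => [sF|sL|sL|]; last by rewrite (negbTE sZ).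
  + exact: layer3_near.
  + exact: layer3_layer1.
  + by apply/negP => ts; apply: nz; exists t => //; exists s.
Qed.


End Layers.



(** * How a further neighbour of v sees the layers *)

Section Attach.
Variables v e w y0 : G.
Hypotheses (ev : e -- v) (wv : w -- v) (y0L : y0 \in layer2 v e).
Local Notation F := (nearL v e).
Local Notation L1 := (layer1 v e).
Local Notation L2 := (layer2 v e).
Local Notation Z := (layer3 v e).

(** If [w] misses [f], it sees [e], or [v e f x w] would be a pentagon; the remaining cases are
    bulls and chairs formed by [w] with the path [v e f x y]. *)
Lemma attach_layer1 x f y : x \in L1 -> f \in F -> y \in L2 -> w -- x -> w -- f /\ w -- y.
Proof.
move=> xL fF yL wx.
have [fv fv' fe] := nearP fF; have [xv xv' xe] := layer1E xL; have xf := layer1_near ev xL fF.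
have [yv yv' ye] := layer2E yL; have yf := layer2_near yL fF; have yx := layer2_layer1 ev yL xL.
have fy := neq_adj fe ye.
have wf : w -- f.
  apply: contraT => wf; have [we|we] := boolP (w -- e); last first.
    by case: (c5F (a:=v) (b:=e) (c:=f) (d:=x) (e:=w)); adj.
  have [wy|wy] := boolP (w -- y).
    by case: (bullF (a:=e) (b:=w) (c:=v) (p:=f) (q:=y)); adj.
  by case: (chairF (c:=x) (a:=y) (b:=f) (d:=w) (e:=v)); adj.
split=> //; apply: contraT => wy.
have [we|we] := boolP (w -- e).
  by case: (bullF (a:=w) (b:=x) (c:=f) (p:=v) (q:=y)); adj.
by case: (bullF (a:=f) (b:=x) (c:=w) (p:=e) (q:=y)); adj.
Qed.

Lemma attach_near_layer2 f y : w != e -> ~~ w -- e -> f \in F -> y \in L2 -> w -- f -> w -- y.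
Proof.
move=> nwe we fF yL wf; have [x xL yx] := layer2_layer1_ex yL.
have [fv fv' fe] := nearP fF; have [xv xv' xe] := layer1E xL; have xf := layer1_near ev xL fF.
have [yv yv' ye] := layer2E yL; have yf := layer2_near yL fF.
have [wx|wx] := boolP (w -- x); first by have [] := attach_layer1 xL fF yL wx.
apply: contraT => wy.
by case: (chairF (c:=f) (a:=e) (b:=w) (d:=x) (e:=y)); adj.
Qed.

Lemma attach_layer2_near f y : w -- e -> f \in F -> y \in L2 -> w -- y -> w -- f.
Proof.
move=> we fF yL wy; apply: contraT => wf.
have [fv fv' fe] := nearP fF; have [yv yv' ye] := layer2E yL; have yf := layer2_near yL fF.
by case: (bullF (a:=e) (b:=w) (c:=v) (p:=f) (q:=y)); adj.
Qed.

Lemma attach_layer2 y y' : y \in L2 -> y' \in L2 -> w -- y -> w -- y'.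
Proof.
move=> yL y'L wy; have [<-//|ny] := eqVneq y y'; apply: contraT => wy'.
have [x xL yx] := layer2_layer1_ex yL; have [f fF] := layer1_near_ex xL.
have [wx|wx] := boolP (w -- x); first by rewrite (proj2 (attach_layer1 xL fF y'L wx)) in wy'.
have yy' := layer2_clique ev yL y'L ny; have y'x := layer2_layer1 ev y'L xL.
have xf := layer1_near ev xL fF; have yf := layer2_near yL fF; have y'f := layer2_near y'L fF.
have [wf|wf] := boolP (w -- f); last first.
  by case: (bullF (a:=x) (b:=y) (c:=y') (p:=f) (q:=w)); adj.
have [fv fv' fe] := nearP fF; have [yv yv' ye] := layer2E yL; have [y'v y'v' y'e] := layer2E y'L.
by case/negP: y'f; apply: (far_not_mixed (v:=v) (w:=w) (f:=y)); adj.
Qed.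

Lemma attach_layer3 z : w -- e -> (forall x, x \in L1 -> ~~ w -- x) -> z \in Z -> ~~ w -- z.
Proof.
move=> we wL1 zZ; apply/negP => wz; have [x xL yx] := layer2_layer1_ex y0L.
have [f fF] := layer1_near_ex xL; have xf := layer1_near ev xL fF.
have [fv fv' fe] := nearP fF; have [xv xv' xe] := layer1E xL; have [zv zv' ze] := layer3E zZ.
have wx := wL1 _ xL; have zx := layer3_layer1 zZ xL; have zf := layer3_near zZ fF.
have [wf|wf] := boolP (w -- f).
  by case: (bullF (a:=f) (b:=w) (c:=e) (p:=x) (q:=z)); adj.
by case: (bullF (a:=e) (b:=w) (c:=v) (p:=f) (q:=z)); adj.
Qed.

(** By star connectivity [w] has a neighbour [f0] that misses [v], and [F] is the only layer where
    [f0] can lie. A member [f] of [F] missed by [w] would give a bull or a chair with [f0], [x],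
    [y0] and [w]. *)
Lemma attach_near f : w -- e -> (forall x, x \in L1 -> ~~ w -- x) -> (forall y, y \in L2 -> ~~ w -- y) ->
  f \in F -> w -- f.
Proof.
move=> we wL1 wL2 fF.
have [x xL yx] := layer2_layer1_ex y0L; have xf := layer1_near ev xL fF.
have [fv fv' fe] := nearP fF; have [xv xv' xe] := layer1E xL.
have [yv yv' ye] := layer2E y0L; have yf := layer2_near y0L fF.
have wx := wL1 _ xL; have wy := wL2 _ y0L.
have [f0 /nearP[f0v f0v' f0w]] := near_ex wv yv yv'.
have f0F : f0 \in F.
  have := mem_far (v:=v) e f0v f0v'; case/or4P=> // [/wL1|/wL2|/(attach_layer3 we wL1)];
    by rewrite sadj_sym f0w.
have xf0 := layer1_near ev xL f0F; have yf0 := layer2_near y0L f0F; have [_ _ f0e] := nearP f0F.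
apply: contraT => wf; have fy := neq_adj fe ye.
have [ff|ff] := boolP (f -- f0).
  by case: (bullF (a:=f0) (b:=x) (c:=f) (p:=w) (q:=y0)); adj.
by case: (chairF (c:=x) (a:=f) (b:=y0) (d:=f0) (e:=w)); adj.
Qed.

End Attach.

Lemma no_layer2_stable :
  (forall v e, e -- v -> layer2 v e = set0) ->
  forall a b c, a != b -> a != c -> b != c -> ~~ a -- b -> ~~ a -- c -> b -- c.
Proof.
move=> noL2 v a b va vb ab nva nvb; apply: contraT => nab.
(* No neighbour of [v] distinguishes two members of [M'], which is thus a module. *)
pose M' := [set m | [&& m != v, ~~ m -- v & [exists m', [&& m' != v, ~~ m' -- v, m' != m & ~~ m' -- m]]]].
have noZ e z : e -- v -> z \in layer3 v e -> False.
  by move=> ev /(layer3_ex_layer2 ev)[z' _ [y yL _]]; move: yL; rewrite noL2 // inE.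
have aM : a \in M'.
  rewrite inE eq_sym va sadj_sym nva; apply/existsP; exists b.
  by rewrite eq_sym vb sadj_sym nvb eq_sym ab sadj_sym nab.
have bM : b \in M'.
  rewrite inE eq_sym vb sadj_sym nvb; apply/existsP; exists a.
  by rewrite eq_sym va sadj_sym nva ab nab.
case: (no_module (X:=M') (u:=v) aM bM ab).
- by rewrite inE eqxx.
- move=> s t t' sM tM t'M st; have [sv|nsv] := boolP (s -- v); last first.
    have sNv : s != v.
      by move: tM st; rewrite inE => /and3P[_ nt _]; apply: contraTneq => ->; rewrite sadj_sym.
    have [t'v nt'v] : t' != v /\ ~~ t' -- v by move: t'M; rewrite inE => /and3P[].
    apply: contraT => st'; case/negP: (sM); rewrite inE sNv nsv; apply/existsP; exists t'.
    rewrite t'v nt'v sadj_sym st' andbT; by apply: contraTneq t'M => ->.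
  move: t'M; rewrite inE => /and3P[t'v nt'v /existsP[m /and4P[mv nmv mt nmt]]].
  apply: contraT => st'; have t's : t' \in farL v s by rewrite inE t'v nt'v sadj_sym.
  (* Missed by [s], the vertex [t'] lies in layer 1 with respect to [s]. There it sees every other
     non-neighbour of [v], in particular [m], against the choice of [m]. *)
  have := mem_far (v:=v) s t'v nt'v; rewrite noL2 // in_set0 /=.
  have -> : (t' \in nearL v s) = false by rewrite inE t'v nt'v sadj_sym (negbTE st').
  case/or3P => [//|t'L|zz]; last by case: (noZ _ _ sv zz).
  have := mem_far (v:=v) s mv nmv; rewrite noL2 // in_set0 /=.
  case/or3P => [mF|mL|zz]; last by case: (noZ _ _ sv zz).
    by move: nmt; rewrite sadj_sym (layer1_near sv t'L mF).
  by rewrite (layer1_clique sv mL t'L mt) in nmt.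
- by move=> t; rewrite inE => /and3P[_ nt _]; rewrite sadj_sym.
Qed.


(** * A third layer forces a vertex of degree at most 2 *)

Section Layer3.
Variables v e z0 : G.
Hypotheses (ev : e -- v) (z0Z : z0 \in layer3 v e).
Local Notation F := (nearL v e).
Local Notation L1 := (layer1 v e).
Local Notation L2 := (layer2 v e).
Local Notation Z := (layer3 v e).

(** Once layer 3 is inhabited, no neighbour of [v] sees layer 1 or 2. This makes [L1], [F] and [L2]
    modules, hence single vertices [x], [f] and [y]. *)
Lemma layer3_degree : exists x f y, forall u, u -- x -> u = f \/ u = y.
Proof.
have [z zZ [y yL zy]] := layer3_ex_layer2 ev z0Z.
have [x xL yx] := layer2_layer1_ex yL; have [f fF] := layer1_near_ex xL.
have zL2 y' : y' \in L2 -> z -- y' by move=> y'L; apply: (layer3_layer2 ev zZ yL).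
have [zv zv' ze] := layer3E zZ; have [xv xv' xe] := layer1E xL.
have [yv yv' ye] := layer2E yL; have [fv fv' fe] := nearP fF.
have xf := layer1_near ev xL fF; have yf := layer2_near yL fF; have zx := layer3_layer1 zZ xL; have zf := layer3_near zZ fF.
(* The vertex [z] is decisive: [x] and [z] are non-adjacent neighbours of [y], and a [w] that sees
   [y] completes a chair or violates [far_not_mixed], whichever of the two it sees. *)
have nonadj w : w -- v -> w != e -> ~~ w -- e -> forall t, [|| t \in F, t \in L1 | t \in L2] -> ~~ w -- t.
  move=> wv nwe we.
  have wy1 y1 : y1 \in L2 -> ~~ w -- y1.
    move=> y1L; apply/negP => /(attach_layer2 ev wv y1L yL) wy.
    have [wx|wx] := boolP (w -- x); last first.
      have [wz|wz] := boolP (w -- z).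
        by case/negP: zx; rewrite sadj_sym; apply: (far_not_mixed (v:=v) (w:=w) (f:=y)); adj.
      have nxz : x != z by apply: contraTneq xL => ->; apply: layer3_notlayer1.
      by case: (chairF (c:=y) (a:=x) (b:=z) (d:=w) (e:=v)); adj.
    have [wf _] := attach_layer1 ev wv xL fF yL wx.
    have [wz|wz] := boolP (w -- z); last first.
      by case/negP: zf; apply: (far_not_mixed (v:=v) (w:=w) (f:=y)); adj.
    have nxz : x != z by apply: contraTneq xL => ->; apply: layer3_notlayer1.
    by case: (chairF (c:=w) (a:=x) (b:=z) (d:=v) (e:=e)); adj.
  move=> t /or3P[tF|tL|]; last exact: wy1.
    by apply: contra (wy1 _ yL) => wt; apply: (attach_near_layer2 ev wv nwe we tF yL).
  by apply: contra (wy1 _ yL) => wt; case: (attach_layer1 ev wv tL fF yL wt).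
have e_far t : t \in L1 \/ t \in L2 -> ~~ e -- t.
  by case=> [/layer1E|/layer2E] [_ _]; rewrite sadj_sym.
have farF w : w -- v -> w -- e -> (exists2 t, t \in L1 :|: L2 & w -- t) ->
    (forall t, t \in F :|: L2 -> w -- t) /\ (forall x1, x1 \in L1 -> w -- x1) /\ w -- z.
  move=> wv we [t tL wt].
  have [wF wL2] : (forall f1, f1 \in F -> w -- f1) /\ (forall y1, y1 \in L2 -> w -- y1).
    case/setUP: tL => tL.
      by split=> [f1 f1F|y1 y1L]; [have [] := attach_layer1 ev wv tL f1F yL wt
                                  |have [] := attach_layer1 ev wv tL fF y1L wt].
    split=> [f1 f1F|y1 y1L]; first exact: (attach_layer2_near ev wv we f1F tL wt).
    exact: (attach_layer2 ev wv tL y1L wt).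
  have wf := wF _ fF; have wy := wL2 _ yL.
  have wz : w -- z.
    by apply: contraT => wz; case/negP: zf; apply: (far_not_mixed (v:=v) (w:=w) (f:=y)); adj.
  split; first by move=> u /setUP[/wF|/wL2].
  split=> // x1 x1L; have [x1v x1v' x1e] := layer1E x1L; apply: contraT => wx1.
  have x1y : x1 -- y by rewrite sadj_sym; apply: (layer2_layer1 ev).
  by case/negP: (layer3_layer1 zZ x1L); rewrite sadj_sym; apply: (far_not_mixed (v:=v) (w:=w) (f:=y)); adj.
have noR w x1 : w -- v -> x1 \in L1 -> ~~ w -- x1.
  move=> wv x1L; apply/negP => wx1.
  (* The members of [R] turn out to be adjacent to all vertices outside [R], which would disconnect
     the complement. *)
  pose R := [set w | (w -- v) && [exists x1 in L1, w -- x1]].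
  have RE a : a \in R -> [/\ a -- v, a -- e & exists2 t, t \in L1 & a -- t].
    rewrite inE => /andP[av /exists_inP[t tL at_]]; split=> //; last by exists t.
    apply: contraT => ae; have [eq_ae|nae] := eqVneq a e.
      by have := e_far t (or_introl tL); rewrite -eq_ae at_.
    by have := nonadj a av nae ae t; rewrite tL orbT at_ => /(_ isT).
  apply: (coC (X:=R) (x:=w) (y:=v)).
  - by rewrite inE wv; apply/exists_inP; exists x1.
  - by rewrite inE sadj_irr.
  move=> a b /RE[av ae [t tL at_]] bR.
  have [aFL2 [aL1 az]] : (forall t, t \in F :|: L2 -> a -- t) /\ (forall x1, x1 \in L1 -> a -- x1) /\ a -- z.
    by apply: farF => //; exists t; rewrite // in_setU tL.
  have af : a -- f by apply: aFL2; rewrite in_setU fF.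
  have [->//|bv] := eqVneq b v.
  have [bv'|bv'] := boolP (b -- v); last first.
    apply: contraT => ab.
    (* Members of [B] can only lie in layer 3, and a non-neighbour [s] of [v] that sees [a] sees
       none of them, by [far_not_mixed] with [s] and [f]. So a star at [v] would cut [B] off from
       [f]. *)
    pose B := [set m | [&& m != v, ~~ m -- v & ~~ m -- a]].
    have bB : b \in B by rewrite inE bv bv' sadj_sym.
    case: (far_connected (v:=v) (B:=B) (u:=f) bB) => //.
    + by rewrite inE (sadj_sym f a) af !andbF.
    + by move=> u; rewrite inE => /and3P[].
    + move=> s u uB sB sv sv'; move: (uB); rewrite inE => /and3P[uv uv' ua].
      have sa : s -- a by move: sB; rewrite inE sv sv' /= negbK.
      apply/negP => su.
      have := mem_far (v:=v) e uv uv'; case/or4P => [uF|uL|uL|uZ].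
      * by move: ua; rewrite sadj_sym aFL2 // in_setU uF.
      * by move: ua; rewrite sadj_sym aL1.
      * by move: ua; rewrite sadj_sym aFL2 // in_setU uL orbT.
      * by case/negP: (layer3_near uZ fF); apply: (far_not_mixed (v:=v) (w:=a) (f:=s)); adj.
  have bL1 u : u \in L1 -> ~~ b -- u.
    by move=> uL; apply: contra bR => bu; rewrite inE bv'; apply/exists_inP; exists u.
  have ax := aL1 _ xL; have bx := bL1 _ xL.
  apply: contraT => ab; have [be|be] := boolP (b -- e).
    have bz := attach_layer3 ev bv' yL be bL1 zZ.
    have nxz : x != z by apply: contraTneq xL => ->; apply: layer3_notlayer1.
    by case: (chairF (c:=a) (a:=x) (b:=z) (d:=v) (e:=b)); adj.
  have [eq_be|nbe] := eqVneq b e; first by move: ab; rewrite eq_be ae.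
  have bf : ~~ b -- f by apply: nonadj => //; rewrite fF.
  have by_ : ~~ b -- y by apply: nonadj => //; rewrite yL !orbT.
  have ay : a -- y by apply: aFL2; rewrite in_setU yL orbT.
  have fy := neq_adj fe ye.
  by case: (chairF (c:=a) (a:=f) (b:=y) (d:=v) (e:=b)); adj.
have nearL2 w y1 : w -- v -> y1 \in L2 -> ~~ w -- y1.
  move=> wv y1L; apply/negP => wy1; have [we|we] := boolP (w -- e).
    have [_ [/(_ x xL)]] : (forall t, t \in F :|: L2 -> w -- t) /\ (forall x1, x1 \in L1 -> w -- x1) /\ w -- z.
      by apply: farF => //; exists y1; rewrite // in_setU y1L orbT.
    by rewrite (negbTE (noR w x wv xL)).
  have [eq_we|nwe] := eqVneq w e; first by have := e_far y1 (or_intror y1L); rewrite -eq_we wy1.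
  by have := nonadj w wv nwe we y1; rewrite y1L wy1 !orbT => /(_ isT).
(* Each layer is now a module missed by [v]. In the case of [F], the vertex [e] and those neighbours
   of [v] that see [e] see all of [F], the other neighbours of [v] none of it. *)
have L1x x1 : x1 \in L1 -> x1 = x.
  move=> x1L; apply/eqP; apply: contraT => nx.
  case: (no_module (X:=L1) (u:=v) x1L xL nx).
  - by apply/negP => /layer1E[]; rewrite eqxx.
  - move=> s t t' sL tL t'L; have [->|sv] := eqVneq s v.
      by have [_ tv _] := layer1E tL; rewrite sadj_sym (negbTE tv).
    have [sv'|sv'] := boolP (s -- v); first by rewrite (negbTE (noR s t sv' tL)).
    have := mem_far (v:=v) e sv sv'; rewrite (negbTE sL) /=; case/or3P => [sF|sL2|sZ] st.
    + by rewrite sadj_sym (layer1_near ev).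
    + exact: (layer2_layer1 ev).
    + by rewrite (negbTE (layer3_layer1 sZ tL)) in st.
  - by move=> t /layer1E[]; rewrite sadj_sym.
have Ff f1 : f1 \in F -> f1 = f.
  move=> f1F; apply/eqP; apply: contraT => nf.
  case: (no_module (X:=F) (u:=v) f1F fF nf).
  - by apply/negP => /nearP[]; rewrite eqxx.
  - move=> s t t' sL tL t'L; have [->|sv] := eqVneq s v.
      by have [_ tv _] := nearP tL; rewrite sadj_sym (negbTE tv).
    have [sv'|sv'] := boolP (s -- v).
      have [->|nse] := eqVneq s e; first by have [_ _] := nearP t'L; rewrite sadj_sym.
      have [se|se] := boolP (s -- e).
        by move=> _; apply: (attach_near ev sv' yL se) => // u uL; [apply: noR|apply: nearL2].
      by have := nonadj s sv' nse se t; rewrite tL => /(_ isT)/negbTE->.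
    have := mem_far (v:=v) e sv sv'; rewrite (negbTE sL) /=; case/or3P => [sL1|sL2|sZ] st.
    + exact: (layer1_near ev).
    + by rewrite (negbTE (layer2_near sL2 tL)) in st.
    + by rewrite (negbTE (layer3_near sZ tL)) in st.
  - by move=> t /nearP[]; rewrite sadj_sym.
have L2y y1 : y1 \in L2 -> y1 = y.
  move=> y1L; apply/eqP; apply: contraT => ny.
  case: (no_module (X:=L2) (u:=v) y1L yL ny).
  - by apply/negP => /layer2E[]; rewrite eqxx.
  - move=> s t t' sL tL t'L; have [->|sv] := eqVneq s v.
      by have [_ tv _] := layer2E tL; rewrite sadj_sym (negbTE tv).
    have [sv'|sv'] := boolP (s -- v); first by rewrite (negbTE (nearL2 s t sv' tL)).
    have := mem_far (v:=v) e sv sv'; rewrite (negbTE sL) /=; case/or3P => [sF|sL1|sZ] st.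
    + by rewrite sadj_sym (negbTE (layer2_near tL sF)) in st.
    + by rewrite sadj_sym (layer2_layer1 ev).
    + exact: (layer3_layer2 ev sZ tL).
  - by move=> t /layer2E[]; rewrite sadj_sym.
exists x, f, y => u ux.
have [eq_uv|uv] := eqVneq u v; first by move: ux; rewrite eq_uv sadj_sym (negbTE xv').
have [uv'|uv'] := boolP (u -- v); first by rewrite (negbTE (noR u x uv' xL)) in ux.
have := mem_far (v:=v) e uv uv'; case/or4P => [/Ff|/L1x eq_ux|/L2y|uZ]; auto.
  by rewrite eq_ux sadj_irr in ux.
by rewrite (negbTE (layer3_layer1 uZ xL)) in ux.
Qed.
End Layer3.

(** Seeing exactly two of [p2], [p4], [p6] yields a bull, seeing exactly one a chair. *)
Lemma hexagon p1 p2 p3 p4 p5 p6 b :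
  p1 -- p2 -> p2 -- p3 -> p3 -- p4 -> p4 -- p5 -> p5 -- p6 -> p6 -- p1 ->
  ~~ p1 -- p3 -> ~~ p1 -- p4 -> ~~ p1 -- p5 -> ~~ p2 -- p4 -> ~~ p2 -- p5 ->
  ~~ p2 -- p6 -> ~~ p3 -- p5 -> ~~ p3 -- p6 -> ~~ p4 -- p6 ->
  b -- p1 -> b -- p3 -> b -- p5 -> b -- p2 = b -- p4 /\ b -- p4 = b -- p6.
Proof.
move=> h12 h23 h34 h45 h56 h61 n13 n14 n15 n24 n25 n26 n35 n36 n46 b1 b3 b5.
have n4_6 : p4 != p6 by apply: (neq_adj (w:=p3)); adj.
have n2_6 : p2 != p6 by apply: (neq_adj (w:=p3)); adj.
have n2_4 : p2 != p4 by apply: (neq_adj (w:=p1)); adj.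
case: (boolP (b -- p2)) => b2; case: (boolP (b -- p4)) => b4;
  case: (boolP (b -- p6)) => b6 //; exfalso.
- by apply: (bullF (a:=p5) (b:=b) (c:=p4) (p:=p6) (q:=p2)); adj.
- by apply: (bullF (a:=p3) (b:=b) (c:=p2) (p:=p4) (q:=p6)); adj.
- by apply: (chairF (c:=p5) (a:=p4) (b:=p6) (d:=b) (e:=p2)); adj.
- by apply: (bullF (a:=p1) (b:=b) (c:=p6) (p:=p2) (q:=p4)); adj.
- by apply: (chairF (c:=p1) (a:=p2) (b:=p6) (d:=b) (e:=p4)); adj.
- by apply: (chairF (c:=p3) (a:=p2) (b:=p4) (d:=b) (e:=p6)); adj.
Qed.

(** * A second layer without a third forces bipartiteness *)

Section Layer2.
Variables v e y : G.
Hypotheses (ev : e -- v) (yL : y \in layer2 v e).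
Hypothesis (noZ : forall z, z \notin layer3 v e).
Local Notation F := (nearL v e).
Local Notation L1 := (layer1 v e).
Local Notation L2 := (layer2 v e).

(** Modules shrink to single vertices until the two sides are [v], [y], [F] and [e], [x], [A], [B],
    where [A] and [B] contain the common neighbours of [v] and [y]. *)
Lemma layer2_bipartite : exists c : G -> bool, forall u u', u -- u' -> c u != c u'.
Proof.
have [x xL yx] := layer2_layer1_ex yL; have [f0 f0F] := layer1_near_ex xL.
have [xv xv' xe] := layer1E xL; have [yv yv' ye] := layer2E yL.
have L2y y1 : y1 \in L2 -> y1 = y.
  move=> y1L; apply/eqP; apply: contraT => ny.
  case: (no_module (X:=L2) (u:=v) y1L yL ny).
  - by apply/negP => /layer2E[]; rewrite eqxx.
  - move=> s t t' sL tL t'L; have [->|sv] := eqVneq s v.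
      by have [_ tv _] := layer2E tL; rewrite sadj_sym (negbTE tv).
    have [sv'|sv'] := boolP (s -- v); first exact: (attach_layer2 ev sv' tL t'L).
    have := mem_far (v:=v) e sv sv'; rewrite (negbTE sL) (negbTE (noZ s)) !orbF /=.
    case/orP => [sF|sL1] st.
    + by rewrite sadj_sym (negbTE (layer2_near tL sF)) in st.
    + by rewrite sadj_sym (layer2_layer1 ev).
  - by move=> t /layer2E[]; rewrite sadj_sym.
pose N := [set w | (w -- v) && ~~ w -- y].
pose A := [set w | [&& w -- v, w -- y & [exists f in F, ~~ w -- f]]].
pose B := [set w | [&& w -- v, w -- y & [forall f in F, w -- f]]].
have Vcase u : [\/ u = v, u = y, u \in F | [\/ u \in L1, u \in N, u \in A | u \in B]].
  have [->|uv] := eqVneq u v; first by constructor.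
  have [uv'|uv'] := boolP (u -- v); last first.
    have := mem_far (v:=v) e uv uv'; rewrite (negbTE (noZ u)) orbF.
    by case/or3P => [uF|uL|/L2y->]; [constructor 3|constructor 4; constructor|constructor 2].
  constructor 4; rewrite [u \in N]inE [u \in A]inE [u \in B]inE uv'.
  have [uy|uy] := boolP (u -- y); last by constructor 2.
  have [fu|] := boolP [forall f in F, u -- f]; first by constructor 4.
  by rewrite negb_forall_in => fu; constructor 3.
have xF f : f \in F -> x -- f by move=> fF; apply: (layer1_near ev).
have L1y x1 : x1 \in L1 -> x1 -- y by move=> x1L; rewrite sadj_sym (layer2_layer1 ev).
have NE n : n \in N -> [/\ n -- v, ~~ n -- y, forall x1, x1 \in L1 -> ~~ n -- x1
    & forall f, f \in F -> n -- f].
  rewrite inE => /andP[nv ny].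
  have nL1 x1 : x1 \in L1 -> ~~ n -- x1.
    by move=> x1L; apply: contra ny => nx; have [] := attach_layer1 ev nv x1L f0F yL nx.
  split=> //; have [->|nne] := eqVneq n e.
    by move=> f /nearP[_ _]; rewrite sadj_sym.
  have [ne|ne] := boolP (n -- e).
    by move=> f; apply: (attach_near ev nv yL) => // y1 /L2y->.
  exfalso; have [m /nearP[mv mv' mn]] := near_ex nv yv yv'.
  have := mem_far (v:=v) e mv mv'; rewrite (negbTE (noZ m)) orbF.
  case/or3P => [mF|mL|/L2y eq_m].
  - by case/negP: ny; apply: (attach_near_layer2 ev nv nne ne mF yL); rewrite sadj_sym.
  - by case/negP: (nL1 _ mL); rewrite sadj_sym.
  - by rewrite sadj_sym eq_m (negbTE ny) in mn.
have eN : e \in N by rewrite inE ev sadj_sym.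
have AE a : a \in A -> [/\ a -- v, a -- y, exists2 f, f \in F & ~~ a -- f,
    forall x1, x1 \in L1 -> ~~ a -- x1 & forall n, n \in N -> ~~ a -- n].
  rewrite inE => /and3P[av ay /exists_inP[f fF af]]; split=> //; first by exists f.
    by move=> x1 x1L; apply: contra af => ax; have [] := attach_layer1 ev av x1L fF yL ax.
  move=> n /NE[nv ny _ /(_ f fF) nf]; apply/negP => an.
  have [fv fv' fe] := nearP fF; have yf := layer2_near yL fF.
  by case: (bullF (a:=n) (b:=a) (c:=v) (p:=f) (q:=y)); adj.
have AF a f f' : a \in A -> f \in F -> f' \in F -> f' -- f -> a -- f -> a -- f'.
  move=> aA fF f'F ff' af; apply: contraT => af'.
  have [av ay _ aL1 aN] := AE _ aA.
  have [fv fv' fe] := nearP fF; have [f'v f'v' f'e] := nearP f'F.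
  by case/negP: (layer2_near yL f'F); rewrite sadj_sym; apply: (far_not_mixed (v:=v) (w:=a) (f:=f)); adj.
have BE b : b \in B -> [/\ b -- v, b -- y & forall f, f \in F -> b -- f].
  by rewrite inE => /and3P[bv by_ /forall_inP].
(* If [A] is empty, all neighbours of [v] see [f0], and a star centred at [f0] separates [v] from
   [y]. *)
have [a0 a0A] : exists a, a \in A.
  apply: NNPP => nA; have [fv fv' fe] := nearP f0F.
  apply: (starC (v:=f0) (B:=[set v]) (b:=v) (u:=y)).
  - by rewrite inE.
  - by rewrite inE.
  - by rewrite inE.
  - by rewrite eq_sym; apply: (neq_adj fe ye).
  - move=> s t; rewrite !inE => /eqP-> sv sf st.
    have [E|E|sF|[sL1|sN|sA|sB]] := Vcase s.
    + by rewrite E eqxx in sv.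
    + by rewrite E (negbTE yv') in st.
    + by have [_ sv' _] := nearP sF; rewrite st in sv'.
    + by have [_ sv' _] := layer1E sL1; rewrite st in sv'.
    + by have [_ _ _] := NE s sN; apply.
    + by case: nA; exists s.
    + by have [_ _] := BE s sB; apply.
  - by move=> t; rewrite inE => /eqP->.
(* Here [v n f x1 y a] is an induced hexagon, of which [b] sees [v], [f] and [y]. *)
have hex a b n x1 : a \in A -> b \in B -> n \in N -> x1 \in L1 ->
    b -- n = b -- x1 /\ b -- x1 = b -- a.
  move=> aA bB nN x1L; have [av ay [f fF af] aL1 aN] := AE _ aA.
  have [bv by_ bF] := BE _ bB; have [nv ny nL1 nF] := NE _ nN.
  have [fv fv' fe] := nearP fF; have yf := layer2_near yL fF; have [_ x1v _] := layer1E x1L.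
  have := @hexagon v n f x1 y a b; apply; try adj.
  - exact: nF.
  - by rewrite sadj_sym; apply: (layer1_near ev).
  - exact: L1y.
  - exact: nL1.
  - by rewrite sadj_sym; apply: aN.
  - by rewrite sadj_sym; apply: aL1.
  - exact: bF.
have Ne n : n \in N -> n = e.
  move=> nN; apply/eqP; apply: contraT => nne.
  case: (no_module (X:=N) (u:=y) nN eN nne).
  - by rewrite inE (negbTE yv').
  - move=> s t t' sN tN t'N.
    have [tv ty tL1 tF] := NE _ tN; have [t'v t'y t'L1 t'F] := NE _ t'N.
    have [->|->|sF|[sL1|sN'|sA|sB]] := Vcase s.
    + by rewrite !(sadj_sym v).
    + by rewrite sadj_sym (negbTE ty).
    + by rewrite !(sadj_sym s) t'F.
    + by rewrite sadj_sym (negbTE (tL1 _ sL1)).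
    + by rewrite sN' in sN.
    + by have [_ _ _ _ aN] := AE _ sA; rewrite (negbTE (aN _ tN)).
    + by rewrite (proj1 (hex _ _ _ _ a0A sB tN xL)) (proj1 (hex _ _ _ _ a0A sB t'N xL)).
  - by move=> t /NE[_ ty _ _]; rewrite sadj_sym.
have L1x x1 : x1 \in L1 -> x1 = x.
  move=> x1L; apply/eqP; apply: contraT => nx.
  case: (no_module (X:=L1) (u:=v) x1L xL nx).
  - by apply/negP => /layer1E[]; rewrite eqxx.
  - move=> s t t' sL tL t'L.
    have [->|->|sF|[sL1|sN'|sA|sB]] := Vcase s.
    + by have [_ tv _] := layer1E tL; rewrite sadj_sym (negbTE tv).
    + by move=> _; apply: (layer2_layer1 ev).
    + by rewrite !(sadj_sym s) (layer1_near ev t'L).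
    + by rewrite sL1 in sL.
    + by have [_ _ nL1 _] := NE _ sN'; rewrite (negbTE (nL1 _ tL)).
    + by have [_ _ _ aL1 _] := AE _ sA; rewrite (negbTE (aL1 _ tL)).
    + by rewrite -(proj1 (hex _ _ _ _ a0A sB eN tL)) (proj1 (hex _ _ _ _ a0A sB eN t'L)).
  - by move=> t /layer1E[]; rewrite sadj_sym.
(* The members of [B] that see [e] would be adjacent to every vertex outside their set, against the
   connectedness of the complement. *)
have Be b : b \in B -> ~~ b -- e.
  move=> bB; apply/negP => be; apply: (coC (X:=[set b in B | b -- e]) (x:=b) (y:=v)).
  - by rewrite inE bB.
  - by rewrite !inE sadj_irr.
  move=> b1 t; rewrite inE => /andP[b1B b1e] tN; have [b1v b1y b1F] := BE _ b1B.
  have b1x : b1 -- x by rewrite -(proj1 (hex _ _ _ _ a0A b1B eN xL)).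
  have [->|->|sF|[sL1|sN'|sA|sB]] := Vcase t => //.
  - exact: b1F.
  - by rewrite (L1x t).
  - by rewrite (Ne t).
  - by rewrite -(proj2 (hex _ _ _ _ sA b1B eN xL)).
  have te : ~~ t -- e by move: tN; rewrite inE sB.
  have tx : ~~ t -- x by rewrite -(proj1 (hex _ _ _ _ a0A sB eN xL)).
  have [tv ty tF] := BE _ sB; apply: contraT => b1t.
  by case: (bullF (a:=v) (b:=b1) (c:=e) (p:=t) (q:=x)); adj.
have Bx b : b \in B -> ~~ b -- x.
  by move=> bB; rewrite -(proj1 (hex _ _ _ _ a0A bB eN xL)) Be.
have BA b a : b \in B -> a \in A -> ~~ b -- a.
  by move=> bB aA; rewrite -(proj2 (hex _ _ _ _ aA bB eN xL)) Bx.
have eA a : a \in A -> ~~ e -- a.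
  by move=> /AE[_ _ _ _ /(_ e eN)]; rewrite sadj_sym.
have xA a : a \in A -> ~~ x -- a.
  by move=> /AE[_ _ _ /(_ x xL) ax _]; rewrite sadj_sym.
have Bb b b' : b \in B -> b' \in B -> b = b'.
  move=> bB b'B; apply/eqP; apply: contraT => nb.
  case: (no_module (X:=B) (u:=e) bB b'B nb).
  - by apply/negP => /BE[_ ey _]; case/negP: ye; rewrite sadj_sym.
  - move=> s t t' sL tL t'L; have [tv ty tF] := BE _ tL; have [t'v t'y t'F] := BE _ t'L.
    have [->|->|sF|[sL1|sN'|sA|sB]] := Vcase s.
    + by rewrite !(sadj_sym v).
    + by rewrite !(sadj_sym y).
    + by rewrite !(sadj_sym s) t'F.
    + by rewrite (L1x s) // sadj_sym (negbTE (Bx _ tL)).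
    + by rewrite (Ne s) // sadj_sym (negbTE (Be _ tL)).
    + by rewrite sadj_sym (negbTE (BA _ _ tL sA)).
    + by rewrite sB in sL.
  - by move=> t tB; rewrite sadj_sym Be.
have AF' a f f' : a \in A -> f \in F -> f' \in F -> f' -- f -> (a -- f) = (a -- f').
  by move=> aA fF f'F ff; apply/idP/idP; apply: AF => //; rewrite sadj_sym.
(* Adjacent members of [F] agree on [A]. Hence the members of [F] that agree with [f] on [A] form a
   module, with at least two vertices if [f] has a neighbour in [F]. Below, [Ast] exchanges the
   roles of [A] and [F]. *)
have Fst f f' : f \in F -> f' \in F -> ~~ f -- f'.
  move=> fF f'F; apply/negP => ff.
  pose X := [set g in F | [forall a in A, (a -- g) == (a -- f)]].
  have XE g : g \in X -> g \in F /\ forall a, a \in A -> a -- g = a -- f.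
    by rewrite inE => /andP[gF /forall_inP h]; split=> // a /h/eqP.
  have fX : f \in X by rewrite inE fF; apply/forall_inP => a aA.
  have f'X : f' \in X by rewrite inE f'F; apply/forall_inP => a aA; rewrite (AF' a f' f).
  case: (no_module (X:=X) (u:=v) fX f'X (adj_neq ff)).
  - by apply/negP => /XE[/nearP[]]; rewrite eqxx.
  - move=> s t t' sL /XE[tF tA] /XE[t'F t'A].
    have [->|->|sF|[sL1|sN'|sA|sB]] := Vcase s.
    + by have [_ tv _] := nearP tF; rewrite sadj_sym (negbTE tv).
    + by rewrite (negbTE (layer2_near yL tF)).
    + move=> st; case/negP: sL; rewrite inE sF; apply/forall_inP => a aA.
      by rewrite -(tA a aA) (AF' a t s).
    + by move=> _; apply: (layer1_near ev).
    + by have [_ _ _ nF] := NE _ sN' => _; apply: nF.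
    + by rewrite tA // t'A.
    + by have [_ _ bF] := BE _ sB => _; apply: bF.
  - by move=> t /XE[/nearP[_ tv _] _]; rewrite sadj_sym.
have AA a a' f : a \in A -> a' \in A -> a -- a' -> f \in F -> a -- f -> a' -- f.
  move=> aA a'A aa fF af; apply: contraT => a'f.
  have [fv fv' fe] := nearP fF; have xf := xF _ fF; have nxe : x != e.
    by apply: contraTneq xL => ->; apply/negP => /layer1E[]; rewrite ev.
  have := eA _ aA; have := eA _ a'A; have := xA _ aA; have := xA _ a'A => ? ? ? ?.
  by case: (chairF (c:=f) (a:=x) (b:=e) (d:=a) (e:=a')); adj.
have Ast a a' : a \in A -> a' \in A -> ~~ a -- a'.
  move=> aA a'A; apply/negP => aa.
  pose X := [set g in A | [forall f in F, (g -- f) == (a -- f)]].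
  have XE g : g \in X -> g \in A /\ forall f, f \in F -> g -- f = a -- f.
    by rewrite inE => /andP[gF /forall_inP h]; split=> // f /h/eqP.
  have tr s t f : s \in A -> t \in A -> s -- t -> f \in F -> s -- f = t -- f.
    by move=> sA tA st fF; apply/idP/idP; apply: AA; rewrite // sadj_sym.
  have aX : a \in X by rewrite inE aA; apply/forall_inP => f fF.
  have a'X : a' \in X.
    by rewrite inE a'A; apply/forall_inP => f fF; rewrite (tr a a').
  case: (no_module (X:=X) (u:=e) aX a'X (adj_neq aa)).
  - by apply/negP => /XE[/AE[_ ey _ _ _] _]; case/negP: ye; rewrite sadj_sym.
  - move=> s t t' sL /XE[tF tA] /XE[t'F t'A].
    have [tv ty _ _ _] := AE _ tF; have [t'v t'y _ _ _] := AE _ t'F.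
    have [->|->|sF|[sL1|sN'|sA|sB]] := Vcase s.
    + by rewrite !(sadj_sym v).
    + by rewrite !(sadj_sym y).
    + by rewrite !(sadj_sym s) t'A // tA.
    + by rewrite (L1x s) // (negbTE (xA _ tF)).
    + by rewrite (Ne s) // (negbTE (eA _ tF)).
    + move=> st; case/negP: sL; rewrite inE sA; apply/forall_inP => f fF.
      by rewrite -(tA f fF) (tr s t).
    + by rewrite (negbTE (BA _ _ sB tF)).
  - by move=> t /XE[tA _]; apply: eA.
pose S := v |: (y |: F).
have Sst u u' : u \in S -> u' \in S -> ~~ u -- u'.
  have vy : ~~ v -- y by adj.
  have Fv f : f \in F -> ~~ f -- v by case/nearP.
  have vF f : f \in F -> ~~ v -- f by move=> /Fv ?; adj.
  have yF f : f \in F -> ~~ y -- f by apply: layer2_near.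
  have Fy f : f \in F -> ~~ f -- y by move=> /yF ?; adj.
  rewrite !in_setU !in_set1 => /or3P[/eqP->|/eqP->|uF] /or3P[/eqP->|/eqP->|u'F];
    rewrite ?sadj_irr //; auto.
pose T u := [\/ u = e, u = x, u \in A | u \in B].
have ST u : u \notin S -> T u.
  rewrite !in_setU !in_set1 !negb_or => /and3P[uv uy uF].
  have [E|E|E|[sL1|sN'|sA|sB]] := Vcase u.
  - by rewrite E eqxx in uv.
  - by rewrite E eqxx in uy.
  - by rewrite E in uF.
  - by constructor 2; apply: L1x.
  - by constructor 1; apply: Ne.
  - by constructor 3.
  - by constructor 4.
have exN : ~~ e -- x by adj.
have eB b : b \in B -> ~~ e -- b by move=> /Be ?; adj.
have xB b : b \in B -> ~~ x -- b by move=> /Bx ?; adj.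
have AB a b : a \in A -> b \in B -> ~~ a -- b by move=> aA bB; rewrite sadj_sym BA.
have Ae a : a \in A -> ~~ a -- e by move=> /eA ?; adj.
have Ax a : a \in A -> ~~ a -- x by move=> /xA ?; adj.
have Tst u u' : T u -> T u' -> ~~ u -- u'.
  move=> [->|->|uA|uB] [->|->|u'A|u'B]; rewrite ?sadj_irr //; auto.
  by rewrite (Bb u u') // sadj_irr.
exists (fun u => u \in S) => u u' uu'; apply/negP => /eqP E.
have [uS|uS] := boolP (u \in S).
  by have := Sst u u' uS; rewrite -E uS uu' => /(_ isT).
by have := Tst u u' (ST _ uS); rewrite uu'; case/(_ _)/negP=> //; apply: ST; rewrite -E.
Qed.
End Layer2.

Lemma dichotomy :
  (forall a b c, a != b -> a != c -> b != c -> ~~ a -- b -> ~~ a -- c -> b -- c) \/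
  (exists c : G -> bool, forall u u', u -- u' -> c u != c u') \/
  (exists x f y, forall u, u -- x -> u = f \/ u = y).
Proof.
have [[v [e [y [ev yL]]]]|noL2] := classic (exists v e y, e -- v /\ y \in layer2 v e).
  right; have [/existsP[z zZ]|noZ] := boolP [exists z, z \in layer3 v e].
    by right; apply: layer3_degree ev zZ.
  left; apply: layer2_bipartite ev yL _ => z; apply: contra noZ => zZ.
  by apply/existsP; exists z.
left; apply: no_layer2_stable => v e ev; apply/setP => y; rewrite in_set0.
by apply/negP => yL; apply: noL2; exists v, e, y.
Qed.

End Dichotomy.

(** * Perfection *)

Lemma periodic_mod (T : Type) n (f : nat -> T) i :
  (forall i, f (i + n) = f i) -> f (i %% n) = f i.
Proof.
move=> fp; rewrite {2}(divn_eq i n); elim: (i %/ n) => [|k IHk]; first by rewrite mul0n add0n.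
by rewrite mulSn -addnA addnC fp.
Qed.

(* An [n]-cycle without chords, given by its [n]-periodic enumeration. *)
Definition hole (T : eqType) (r : rel T) (n : nat) (h : nat -> T) :=
  [/\ forall i, h (i + n) = h i,
      forall i a, a < n -> (h i == h (i + a)) = (a == 0) &
      forall i a, a < n -> r (h i) (h (i + a)) = (a == 1) || (a == n.-1)].

Definition walk (T : eqType) (r : rel T) (n : nat) (h : nat -> T) :=
  (forall i, h (i + n) = h i) /\ (forall i, r (h i) (h i.+1)).

Section OddHole.
Variables (T : finType) (r : rel T).
Hypotheses (rS : symmetric r) (rI : irreflexive r).

Lemma walk_sub n h s L : walk r n h -> 0 < L -> r (h (s + L.-1)) (h s) ->
  walk r L (fun j => h (s + j %% L)).
Proof.
move=> [hn hr] L0 rL; split=> [i|i]; first by rewrite modnDr.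
have iL := ltn_pmod i L0.
have [lt|ge] := ltnP (i %% L).+1 L.
  have -> : i.+1 %% L = (i %% L).+1 by rewrite -addn1 -modnDml addn1 modn_small.
  by rewrite addnS.
have E : i %% L = L.-1 by lia.
have -> : i.+1 %% L = 0 by rewrite -addn1 -modnDml E addn1 prednK ?modnn.
by rewrite E addn0.
Qed.

(** A repeated vertex or a chord splits an odd closed walk into two shorter closed walks, one of
    them odd. A shortest odd closed walk is thus a hole; a triangle counts as a hole of length 3. *)
Lemma odd_walk_hole n h : walk r n h -> odd n -> exists n h, [/\ odd n, 2 < n & hole r n h].
Proof.
elim/ltn_ind: n h => n IH h wh on; have [hn hr] := wh.
have n3 : 2 < n.
  case: n on hn {IH wh} => [|[|[|n]]] // _ hn.
  by have := hr 0; rewrite -[1]/(0 + 1) hn rI.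
have step s L : 0 < L -> L < n -> odd L -> r (h (s + L.-1)) (h s) ->
    exists n h, [/\ odd n, 2 < n & hole r n h].
  by move=> L0 Ln oL rL; apply: IH (walk_sub wh L0 rL) oL.
have [[i [a [a0 an E]]]|ninj] := classic (exists i a, [/\ 0 < a, a < n & h i = h (i + a)]).
  have [oa|ea] := boolP (odd a).
    apply: (step i a) => //; rewrite E.
    by have := hr (i + a.-1); rewrite -addnS prednK.
  apply: (step (i + a) (n - a)); [lia|lia|lia|].
  rewrite -E -[h i]hn; have := hr (i + a + (n - a).-1).
  by have -> : (i + a + (n - a).-1).+1 = i + n by lia.
have [[i [a [a1 an E]]]|nch] := classic (exists i a, [/\ 1 < a, a < n.-1 & r (h i) (h (i + a))]).
  have [oa|ea] := boolP (odd a).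
    apply: (step (i + a) (n - a).+1); [lia|lia|lia|].
    by have -> : i + a + (n - a).+1.-1 = i + n; [lia|rewrite hn].
  by apply: (step i a.+1); [lia|lia|lia|rewrite rS].
exists n, h; split=> //; split=> // i a an.
  case: a an => [|a] an; first by rewrite addn0 eqxx.
  by apply/eqP => E; apply: ninj; exists i, a.+1.
have [->|a0] := eqVneq a 0; first by rewrite addn0 rI; lia.
have [->|a1] := eqVneq a 1; first by rewrite addn1 hr.
have [->|an1] := eqVneq a n.-1.
  by rewrite rS -[h i]hn; have := hr (i + n.-1); rewrite -addnS prednK // (leq_trans _ n3).
by apply/negbTE/negP => E; apply: nch; exists i, a; split=> //; lia.
Qed.

(* The bipartite double cover: an odd closed walk at [x] leads from [(x, false)] to [(x, true)]. *)
Definition cover_rel (x y : T * bool) := r x.1 y.1 && (x.2 != y.2).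

(** Without odd closed walks, [(root x, false)] reaches exactly one of the two copies of [x], and
    this copy determines the color. The relation is left general because the complement is needed as
    well. *)
Lemma odd_hole_or_bipartite :
  (exists n h, [/\ odd n, 2 < n & hole r n h]) \/
  exists c : T -> bool, forall x y, r x y -> c x != c y.
Proof.
have [[x xx]|nox] := classic (exists x, connect cover_rel (x, false) (x, true)).
  left; have /connectP[p pp] := xx; have : (x, true) = (x, true) by [].
  move: xx => _.
  have par : forall (q : seq (T * bool)) z, path cover_rel z q ->
      path r z.1 (map fst q) /\ (last z q).2 = z.2 (+) odd (size q).
    elim=> [|y q IHq] z /=; first by rewrite addbF.
    case/andP => /andP[rzy zy] /IHq[-> ->]; rewrite rzy; split=> //.
    by case: (z.2) (y.2) zy (odd _) => [] [] // _ [].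
  move=> _ E; have [pr] := par _ _ pp; rewrite -E /= => op.
  set s := map fst p in pr; have ls : last x s = x by rewrite -[x]/((x, false).1) last_map -E.
  have os : odd (size s) by rewrite size_map -op.
  have s0 : 0 < size s by case: (size s) os.
  apply: (@odd_walk_hole (size s) (fun i => nth x s (i %% size s))) => //.
  split=> i; first by rewrite modnDr.
  have iL := ltn_pmod i s0; have [lt|ge] := ltnP (i %% size s).+1 (size s).
    have -> : i.+1 %% size s = (i %% size s).+1 by rewrite -addn1 -modnDml addn1 modn_small.
    exact: (pathP x pr (i %% size s).+1).
  have Ei : i %% size s = (size s).-1 by lia.
  have -> : i.+1 %% size s = 0 by rewrite -addn1 -modnDml Ei addn1 prednK ?modnn.
  by rewrite Ei nth_last ls; apply: (pathP x pr 0).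
right.
have cS : connect_sym cover_rel.
  by apply: sym_connect_sym => x y; rewrite /cover_rel rS eq_sym.
have flip x y b b' : connect cover_rel (x, b) (y, b') -> connect cover_rel (x, ~~ b) (y, ~~ b').
  pose f (z : T * bool) := (z.1, ~~ z.2).
  suff H z z' : connect cover_rel z z' -> connect cover_rel (f z) (f z') by move/H.
  case/connectP => p; elim: p z => [|t p IHp] z /=; first by move=> _ ->.
  case/andP => zt pt E; apply: connect_trans (IHp _ pt E); apply: connect1.
  by move: zt; rewrite /cover_rel /= (inj_eq negb_inj).
pose root := root r; have rC : connect_sym r by apply: sym_connect_sym.
exists (fun x => connect cover_rel (root x, false) (x, true)) => x y rxy.
have Eroot : root x = root y by apply/eqP; rewrite root_connect // connect1.
rewrite -Eroot; set z := root x.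
have [b zx] : exists b, connect cover_rel (z, false) (x, b).
  have : connect r z x by rewrite rC connect_root.
  case/connectP => p; elim: p z false => [|t p IHp] z b0 /=.
    by move=> _ ->; exists b0; apply: connect0.
  case/andP => zt pt E; have [b tb] := IHp t (~~ b0) pt E; exists b.
  by apply: connect_trans tb; apply: connect1; rewrite /cover_rel /= zt; case: b0.
have xy b' : connect cover_rel (x, b') (y, ~~ b').
  by apply: connect1; rewrite /cover_rel /= rxy; case: b'.
have zy := connect_trans zx (xy b).
have unq t : ~ (connect cover_rel (z, false) (t, false) /\ connect cover_rel (z, false) (t, true)).
  by case=> H1 H2; apply: nox; exists t; apply: connect_trans H2; rewrite cS.
case: b zx zy => zx zy.
  by rewrite zx; apply/negP => /eqP E; apply: (unq y); rewrite zy -E.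
by rewrite zy; apply/negP => /eqP E; apply: (unq x); rewrite zx E.
Qed.

End OddHole.

Definition coadj (G : sgraph) : rel G := fun x y => (x != y) && ~~ x -- y.

Lemma coadj_sym (G : sgraph) : symmetric (@coadj G).
Proof. by move=> x y; rewrite /coadj eq_sym sadj_sym. Qed.

Lemma coadj_irr (G : sgraph) : irreflexive (@coadj G).
Proof. by move=> x; rewrite /coadj eqxx. Qed.

Definition induced (G : sgraph) (A : {set G}) : sgraph :=
  @SGraph {x : G | x \in A} (fun x y => val x -- val y)
    (fun x y => sadj_sym (val x) (val y)) (fun x => sadj_irr (val x)).

(** * Colorings and cliques inside vertex sets *)

Section Colorings.
Variable G : sgraph.
Implicit Types (A B K : {set G}) (q : nat).

Definition colset A q := exists c : G -> nat,
  (forall x, x \in A -> c x < q) /\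
  (forall x y, x \in A -> y \in A -> x -- y -> c x <> c y).

Definition clique K := [forall x in K, forall y in K, (x != y) ==> x -- y].

Definition omega_le A q := forall K, K \subset A -> clique K -> #|K| <= q.

Lemma cliqueP K : reflect (forall x y, x \in K -> y \in K -> x != y -> x -- y) (clique K).
Proof.
apply: (iffP forall_inP) => [h x y xK yK nxy|h x xK].
  by have /forall_inP/(_ y yK)/implyP := h x xK; apply.
by apply/forall_inP => y yK; apply/implyP; apply: h.
Qed.

Lemma colset_le A p q : p <= q -> colset A p -> colset A q.
Proof.
move=> pq [c [c1 c2]]; exists c; split=> // x /c1 h; exact: leq_trans h pq.
Qed.

Lemma colsetU A B p q : colset A p -> colset B q -> colset (A :|: B) (p + q).
Proof.
move=> [c [c1 c2]] [d [d1 d2]].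
exists (fun x => if x \in A then c x else p + d x); split=> [x|x y]; rewrite !inE.
  by case: ifP => [/c1|_ /d1]; lia.
case: ifP => [xA|xA] /=; case: ifP => [yA|yA] /=.
- by move=> _ _; apply: c2.
- by move=> _ yB _; have := c1 _ xA; lia.
- by move=> xB _ _; have := c1 _ yA; lia.
- by move=> xB yB /(d2 _ _ xB yB); lia.
Qed.

Lemma colset_stable A : (forall x y, x \in A -> y \in A -> ~~ x -- y) -> colset A 1.
Proof.
move=> sA; exists (fun=> 0); split=> // x y xA yA xy.
by have := sA _ _ xA yA; rewrite xy.
Qed.

Lemma colset_union A B q : (forall x y, x \in A -> y \in B -> ~~ x -- y) ->
  colset A q -> colset B q -> colset (A :|: B) q.
Proof.
move=> nAB [c [c1 c2]] [d [d1 d2]].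
have BA x y : x \in A -> y \in B -> x -- y -> False.
  by move=> xA yB; apply/negP; apply: nAB.
exists (fun x => if x \in A then c x else d x); split=> [x|x y]; rewrite !inE.
  by case: ifP => [/c1|_ /d1].
case: ifP => [xA|xA] /=; case: ifP => [yA|yA] /=.
- by move=> _ _; apply: c2.
- by move=> _ yB xy; case: (BA x y).
- by move=> xB _ xy; case: (BA y x); rewrite // sadj_sym.
- exact: d2.
Qed.

(** Colors that [K] avoids lower the bound on its size; in the use below, [s] consists of the color
    of the centre of a star cutset. *)
Lemma clique_card K A q (c : G -> nat) : clique K -> K \subset A ->
  (forall x, x \in A -> c x < q) ->
  (forall x y, x \in A -> y \in A -> x -- y -> c x <> c y) ->
  forall s, (forall x, x \in K -> c x \notin s) -> uniq s -> all (fun i => i < q) s ->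
  #|K| + size s <= q.
Proof.
move=> /cliqueP cK /subsetP KA c1 c2 s Ks us as_.
have : uniq (map c (enum K) ++ s).
  rewrite cat_uniq us andbT; apply/andP; split.
    rewrite map_inj_in_uniq ?enum_uniq // => x y; rewrite !mem_enum => xK yK E.
    apply/eqP; apply: contraT => nxy; case: (c2 x y (KA _ xK) (KA _ yK)) => //.
    exact: cK.
  apply/hasPn => i iS; apply/mapP => -[x]; rewrite mem_enum => /Ks + Ei.
  by rewrite -Ei iS.
move/(@uniq_leq_size _ _ (iota 0 q)); rewrite size_cat size_map -cardE size_iota; apply.
move=> i; rewrite mem_cat mem_iota /= => /orP[/mapP[x]|/(allP as_)//].
by rewrite mem_enum => /KA/c1 + ->.
Qed.

Lemma omega_ex A : exists K, [/\ K \subset A, clique K & omega_le A #|K|].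
Proof.
have h0 : (set0 \subset A) && clique (set0 : {set G}).
  by rewrite sub0set; apply/cliqueP => x y; rewrite inE.
case: (arg_maxnP (P := fun K : {set G} => (K \subset A) && clique K) (fun K : {set G} => #|K|) h0).
move=> K /andP[KA cK] maxK; exists K; split=> // K' K'A cK'.
by apply: maxK; rewrite K'A.
Qed.

Lemma colset_induced A q : colset A q <->
  exists c : induced A -> nat, (forall x, c x < q) /\ (forall x y : induced A, x -- y -> c x <> c y).
Proof.
split=> [[c [c1 c2]]|[c [c1 c2]]].
  exists (fun x : induced A => c (val x)); split=> [x|x y xy]; first exact: c1 (valP x).
  exact: c2 (valP x) (valP y) xy.
exists (fun x => if insub x is Some u then c u else 0); split=> [x xA|x y xA yA xy].
  by rewrite insubT.
by rewrite !insubT; apply: c2.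
Qed.

End Colorings.

Record tame (G : sgraph) : Prop := Tame {
  tame_bull : bull_free G;
  tame_chair : chair_free G;
  tame_pentagon : pentagon_free G }.

Record berge (G : sgraph) : Prop := Berge {
  berge_tame : tame G;
  berge_hole : forall n h, odd n -> 6 < n -> ~ hole (@sadj G) n h;
  berge_antihole : forall n h, odd n -> 6 < n -> ~ hole (@coadj G) n h }.

Lemma hole_inj (T T' : eqType) (f : T -> T') (r : rel T) (r' : rel T') n h :
  injective f -> (forall x y, r' (f x) (f y) = r x y) -> hole r n h -> hole r' n (f \o h).
Proof.
move=> fI fr [h1 h2 h3]; split=> [i|i a an|i a an] /=; first by rewrite h1.
  by rewrite inj_eq // h2.
by rewrite fr h3.
Qed.

Lemma tame_induced G A : tame G -> tame (@induced G A).
Proof.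
move=> [b c p]; split.
- by move=> x1 x2 x3 x4 x5; apply: b.
- by move=> x1 x2 x3 x4 x5; apply: c.
- by move=> x1 x2 x3 x4 x5; apply: p.
Qed.

Lemma berge_induced G A : berge G -> berge (@induced G A).
Proof.
move=> [t h ah]; split; first exact: tame_induced.
  move=> n g on n7 hg; apply: (h n (val \o g) on n7).
  by apply: hole_inj hg; [exact: val_inj|].
move=> n g on n7 hg; apply: (ah n (val \o g) on n7).
by apply: hole_inj hg; [exact: val_inj|].
Qed.

Lemma cards_disjointU (T : finType) (A B : {set T}) :
  (forall z, z \in A -> z \notin B) -> #|A :|: B| = #|A| + #|B|.
Proof.
move=> dAB; rewrite cardsU; suff -> : A :&: B = set0 by rewrite cards0 subn0.
by apply/setP => z; rewrite !inE; apply/negP => /andP[/dAB/negbTE->].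
Qed.

(** * Minimal imperfect graphs *)

Section Minimal.
Variables (G : sgraph) (q : nat).
Hypothesis IH : forall (A : {set G}) p, A != setT -> omega_le A p -> colset A p.
Hypotheses (om : omega_le [set: G] q) (nocol : ~ colset [set: G] q).

Lemma proper_notin (A : {set G}) x : x \notin A -> A != setT.
Proof. by apply: contraNneq => ->; rewrite inE. Qed.

Lemma omegaS (A : {set G}) : omega_le A q.
Proof. by move=> K _; apply: om; apply: subsetT. Qed.

(** The clique numbers of two completely joined parts add up, and the parts can be colored with
    disjoint palettes. *)
Lemma minimal_coconnected : coconnected G.
Proof.
move=> X x y xX yX cXY; apply: nocol.
have [K [KX cK mK]] := omega_ex X; have [L [LX cL mL]] := omega_ex (~: X).
have : #|K| + #|L| <= q.
  have <- : #|K :|: L| = #|K| + #|L|.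
    apply: cards_disjointU => z /(subsetP KX) zX.
    by apply/negP => /(subsetP LX); rewrite inE zX.
  apply: om (subsetT _) _; apply/cliqueP => a b; rewrite !inE.
  move=> /orP[aK|aL] /orP[bK|bL] nab.
  - exact: (cliqueP _ cK).
  - by apply: cXY; [apply: (subsetP KX)|have := subsetP LX _ bL; rewrite inE].
  - by rewrite sadj_sym; apply: cXY; [apply: (subsetP KX)|have := subsetP LX _ aL; rewrite inE].
  - exact: (cliqueP _ cL).
move=> KLq; apply: (colset_le KLq); rewrite -(setUCr X); apply: colsetU.
  by apply: IH mK; apply: proper_notin yX.
by apply: IH mL; apply: (@proper_notin _ x); rewrite inE negbK.
Qed.

(** Chvatal's star cutset lemma. A clique lies in [B :|: S] or avoids [B], and both sides have a
    [q]-coloring. Removing a stable set that contains the color class of [v] on either side leaves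
    only cliques with fewer than [q] vertices. *)
Lemma minimal_star_connected : star_connected G.
Proof.
move=> v B b u bB vB uB uv cB uN; apply: nocol.
pose S := [set s in ~: B | (s == v) || [exists t in B, s -- t]].
have SE s : s \in S -> s != v -> s -- v.
  rewrite !inE => /andP[sB /orP[/eqP->|/exists_inP[t tB st]]]; first by rewrite eqxx.
  by move=> sv; apply: (cB s t).
have vS : v \in S by rewrite !inE vB eqxx.
have uS : u \notin S.
  rewrite !inE uB (negbTE uv) /=; apply/exists_inP => -[t tB].
  by rewrite (negbTE (uN _ tB)).
have [c [c1 c2]] : colset (B :|: S) q.
  by apply: IH (@omegaS _); apply: (@proper_notin _ u); rewrite in_setU negb_or uB.
have [d [d1 d2]] : colset (~: B) q.
  by apply: IH (@omegaS _); apply: (@proper_notin _ b); rewrite inE bB.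
have vBS : v \in B :|: S by rewrite in_setU vS orbT.
have vCB : v \in ~: B by rewrite inE.
have SC s : s \in S -> s \in ~: B by rewrite inE => /andP[].
(* The color classes of [v] in the two colorings form together one stable set. *)
pose S0 := [set x | ((x \in B :|: S) && (c x == c v)) || ((x \in ~: B) && (d x == d v))].
have q0 : 0 < q by apply: leq_trans (d1 _ vCB).
have S0S x : x \in S0 -> x \in S -> x = v.
  move=> xS0 xS; apply/eqP; apply: contraT => xv; have xv' := SE _ xS xv.
  have xBS : x \in B :|: S by rewrite in_setU xS orbT.
  move: xS0; rewrite inE => /orP[/andP[_ /eqP]|/andP[_ /eqP]].
    by move/(c2 _ _ xBS vBS xv').
  by move/(d2 _ _ (SC _ xS) vCB xv').
have sS0 : forall x y, x \in S0 -> y \in S0 -> ~~ x -- y.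
  have half x y : x \in S0 -> y \in S0 -> x \in B -> ~~ x -- y.
    move=> xS yS xB; apply/negP => xy; have xBS : x \in B :|: S by rewrite in_setU xB.
    have xc : c x = c v.
      by move: xS; rewrite inE xBS !inE xB /= orbF => /eqP.
    have [yB|yB] := boolP (y \in B).
      have yBS : y \in B :|: S by rewrite in_setU yB.
      apply: (c2 x y xBS yBS xy); rewrite xc; apply/esym.
      by move: yS; rewrite inE yBS !inE yB /= orbF => /eqP.
    have yS' : y \in S.
      by rewrite !inE yB; apply/orP; right; apply/exists_inP; exists x; rewrite // sadj_sym.
    by move: xy; rewrite (S0S y) // => /(c2 _ _ xBS vBS).
  move=> x y xS yS; have [xB|xB] := boolP (x \in B); first exact: half.
  have [yB|yB] := boolP (y \in B); first by rewrite sadj_sym half.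
  have dd z : z \in S0 -> z \notin B -> d z = d v.
    move=> zS0 zB; move: (zS0); rewrite inE in_setU (negbTE zB) /=.
    case/orP => [/andP[zS _]|/andP[_ /eqP//]]; by rewrite (S0S z).
  apply/negP => xy; apply: (d2 x y _ _ xy); rewrite ?inE //.
  by rewrite !dd.
have qE : q = 1 + q.-1 by lia.
rewrite qE -(setUCr S0); apply: colsetU; first exact: colset_stable.
apply: IH.
  by apply: (@proper_notin _ v); rewrite in_setC negbK inE vBS eqxx.
move=> K KS cK; suff : #|K| + 1 <= q by lia.
have KS0 x : x \in K -> x \notin S0 by move=> /(subsetP KS); rewrite inE.
have [/existsP[k /andP[kK kB]]|] := boolP [exists k, (k \in K) && (k \in B)].
  have KA : K \subset B :|: S.
    apply/subsetP => x xK; rewrite in_setU; have [//|xB] := boolP (x \in B).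
    rewrite /= !inE xB /=; apply/orP; right; apply/exists_inP; exists k => //.
    by apply: (cliqueP _ cK) => //; apply: contraNneq xB => ->.
  apply: (clique_card cK KA c1 c2 (s:=[:: c v])) => //=; last by rewrite c1.
  move=> x xK; rewrite inE; apply: contra (KS0 _ xK) => xc.
  by rewrite inE (subsetP KA) // xc.
rewrite negb_exists => /forallP kB.
have KA : K \subset ~: B.
  by apply/subsetP => x xK; rewrite inE; have := kB x; rewrite xK.
apply: (clique_card cK KA d1 d2 (s:=[:: d v])) => //=; last by rewrite d1.
move=> x xK; rewrite inE; apply: contra (KS0 _ xK) => xd.
by rewrite inE (subsetP KA) // xd orbT.
Qed.

(* A [q]-clique avoiding two non-adjacent vertices splits the graph into two
   parts whose clique numbers add up to [q]; if there is none, these two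
   vertices can share a color. *)
Lemma minimal_cobipartite (c : G -> bool) :
  (forall x y, coadj x y -> c x != c y) -> False.
Proof.
move=> cP; apply: nocol.
have adjc x y : x != y -> c x = c y -> x -- y.
  move=> nxy E; apply: contraT => xy; have := cP x y.
  by rewrite /coadj nxy xy E eqxx => /(_ isT).
have [[x [y [xc yc xy]]]|nxy] := classic (exists x y, [/\ c x, ~~ c y & ~~ x -- y]); last first.
  have cT : clique [set: G].
    apply/cliqueP => x y _ _ neq; have [E|E] := eqVneq (c x) (c y); first exact: adjc.
    apply: contraT => xy; case: nxy.
    case cx: (c x); [exists x, y|exists y, x]; split; rewrite ?cx // 1?sadj_sym //.
      by move: E; rewrite cx; case: (c y).
    by move: E; rewrite cx; case: (c y).
  exists (fun x => enum_rank x : nat); split=> [x _|x y _ _ xy E].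
    by apply: leq_trans (ltn_ord _) _; rewrite -cardsT; apply: om.
  by move: xy; rewrite (enum_rank_inj (ord_inj E)) sadj_irr.
have nxy : x != y by apply: contraNneq yc => <-.
have q0 : 0 < q.
  have := om (subsetT [set x]); rewrite cards1; apply; apply/cliqueP => a b.
  by rewrite !inE => /eqP-> /eqP->; rewrite eqxx.
have [ol|] := classic (omega_le (~: [set x; y]) q.-1).
  have -> : q = 1 + q.-1 by lia.
  rewrite -(setUCr [set x; y]); apply: colsetU.
    apply: colset_stable => a b; rewrite !inE.
    by move=> /orP[]/eqP-> /orP[]/eqP->; rewrite ?sadj_irr // sadj_sym.
  by apply: IH ol; apply: (@proper_notin _ x); rewrite !inE eqxx.
move=> nol.
have [K [KS cK Kq]] : exists K : {set G}, [/\ K \subset ~: [set x; y], clique K & q <= #|K|].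
  apply: NNPP => nK; apply: nol => K KS cK; apply: contraT; rewrite -ltnNge => lt.
  by case: nK; exists K; split=> //; lia.
have xK : x \notin K by apply/negP => /(subsetP KS); rewrite !inE eqxx.
have yK : y \notin K by apply/negP => /(subsetP KS); rewrite !inE eqxx orbT.
pose X' := [set z in K | c z]; pose Y' := [set z in K | ~~ c z].
have KXY : #|K| = #|X'| + #|Y'|.
  by rewrite -(cardsID [set z | c z] K); congr (_ + _); apply: eq_card => z; rewrite !inE // andbC.
(* A clique of [G1] and the other half [Y'] of [K] form a clique together, so it has at most as many
   vertices as [X']; likewise for the complement of [G1] and [X']. *)
pose G1 := X' :|: [set z | ~~ c z & z \notin K].
have KC := cliqueP _ cK.
have o1 : omega_le G1 #|X'|.
  move=> P PG cP'; have PC := cliqueP _ cP'.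
  have disj : #|P :|: Y'| = #|P| + #|Y'|.
    apply: cards_disjointU => z /(subsetP PG).
    by rewrite !inE => /orP[/andP[-> ->]|/andP[-> /negbTE->]].
  have : #|P :|: Y'| <= q.
    apply: om (subsetT _) _; apply/cliqueP.
    have PY a b : a \in P -> b \in Y' -> a != b -> a -- b.
      move=> /(subsetP PG); rewrite !inE => /orP[/andP[aK _]|/andP[ac _]] /andP[bK bc] nab.
        exact: KC.
      by apply: adjc => //; rewrite (negbTE ac) (negbTE bc).
    move=> a b; rewrite !(in_setU _ P) => /orP[aP|aY] /orP[bP|bY] nab.
    - exact: PC.
    - exact: PY.
    - by rewrite sadj_sym PY // eq_sym.
    - by move: aY bY; rewrite !inE => /andP[aK _] /andP[bK _]; apply: KC.
  by lia.
have o2 : omega_le (~: G1) #|Y'|.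
  move=> P PG cP'; have PC := cliqueP _ cP'.
  have disj : #|P :|: X'| = #|P| + #|X'|.
    by apply: cards_disjointU => z /(subsetP PG); rewrite !inE negb_or => /andP[].
  have : #|P :|: X'| <= q.
    apply: om (subsetT _) _; apply/cliqueP.
    have PX a b : a \in P -> b \in X' -> a != b -> a -- b.
      move=> /(subsetP PG); rewrite !inE negb_or !negb_and !negbK => /andP[h1 h2] /andP[bK bc] nab.
      have [ac|ac] := boolP (c a); first by apply: adjc; rewrite // ac bc.
      by apply: KC => //; move: h2; rewrite (negbTE ac).
    move=> a b; rewrite !(in_setU _ P) => /orP[aP|aY] /orP[bP|bY] nab.
    - exact: PC.
    - exact: PX.
    - by rewrite sadj_sym PX // eq_sym.
    - by move: aY bY; rewrite !inE => /andP[aK _] /andP[bK _]; apply: KC.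
  by lia.
have KleQ : #|X'| + #|Y'| <= q by rewrite -KXY; apply: om; rewrite ?subsetT.
apply: (colset_le KleQ); rewrite -(setUCr G1); apply: colsetU.
  by apply: IH o1; apply: (@proper_notin _ x); rewrite !inE xc (negbTE xK).
by apply: IH o2; apply: (@proper_notin _ y); rewrite !inE yc yK !orbT.
Qed.

Lemma minimal_degree (x f y : G) : 2 < q -> (forall u, u -- x -> u = f \/ u = y) -> False.
Proof.
move=> q3 dx; apply: nocol.
have [c [c1 c2]] : colset (~: [set x]) q.
  by apply: IH (@omegaS _); apply: (@proper_notin _ x); rewrite !inE eqxx.
pose k := if (c f != 0) && (c y != 0) then 0 else if (c f != 1) && (c y != 1) then 1 else 2.
have kq : k < q by rewrite /k; do 2?case: ifP => _; lia.
have kf : c f <> k /\ c y <> k.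
  by rewrite /k; do 2?case: ifP; lia.
exists (fun u => if u == x then k else c u); split=> [u _|u w _ _].
  by case: eqP => // /eqP ux; apply: c1; rewrite !inE.
case: eqP => [->|ux]; case: eqP => [->|wx]; rewrite ?sadj_irr //.
- by rewrite sadj_sym => /dx[]->; case: kf => ? ? /esym.
- by move=> /dx[]->; case: kf.
- by apply: c2; rewrite !inE; apply/eqP.
Qed.

End Minimal.

(** Coloring a vertex of degree 2 last takes a third color, hence the separate treatment of
    [q <= 2]: there are no triangles then, and the absence of odd holes already gives a
    bipartition. *)
Lemma berge_perfect G : berge G -> forall q, omega_le [set: G] q -> colset [set: G] q.
Proof.
have [m] := ubnP #|G|; elim: m G => // m IHm G Gm bG q om.
have IH (A : {set G}) p : A != setT -> omega_le A p -> colset A p.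
  move=> AT oA; apply/colset_induced.
  have Alt : #|induced A| < m.
    have -> : #|induced A| = #|A| by rewrite card_sig.
    apply: leq_trans (_ : #|A|.+1 <= #|G|) _; last by rewrite -ltnS.
    by rewrite -cardsT; apply: proper_card; rewrite properT.
  have [|c [c1 c2]] := IHm _ Alt (berge_induced _ bG) p.
    move=> K _ cK; rewrite -(card_imset _ (@val_inj _ _ _)); apply: oA.
      by apply/subsetP => x /imsetP[[y yA] _ ->].
    apply/cliqueP => x y /imsetP[x' xK ->] /imsetP[y' yK ->] nxy.
    by apply: (cliqueP _ cK x' y') => //; apply: contraNneq nxy => ->.
  by exists c; split=> [x|x y]; [apply: c1|apply: c2]; rewrite inE.
apply: NNPP => nocol; have [[tb tc tp] bh bah] := bG.
have bip (c : G -> bool) : (forall u u', u -- u' -> c u != c u') -> 1 < q -> False.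
  move=> cP q1; apply: nocol; exists c; split=> [x _|x y _ _ xy].
    by case: (c x); lia.
  by have := cP _ _ xy; do 2!case: (c _).
have [q2|q2] := ltnP 2 q; last first.
  have big (x : G) : #|[set x]| <= q.
    by apply: om (subsetT _) _; apply/cliqueP => a b; rewrite !inE => /eqP-> /eqP->; rewrite eqxx.
  have edge (x y : G) : x -- y -> 1 < q.
    move=> xy; have := om [set x; y] (subsetT _); rewrite cards2 (adj_neq xy); apply.
    apply/cliqueP => a b; rewrite !inE => /orP[]/eqP-> /orP[]/eqP->; rewrite ?eqxx //.
    by rewrite sadj_sym.
  have [[x [y xy]]|noe] := classic (exists x y : G, x -- y); last first.
    apply: nocol; exists (fun=> 0); split=> [x _|x y _ _ xy]; last by case: noe; exists x, y.
    by have := big x; rewrite cards1.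
  have [[n [h [on n2 [hn hi hh]]]]|[c cP]] := odd_hole_or_bipartite (@sadj_sym G) (@sadj_irr G);
    last by apply: (bip c cP); apply: edge xy.
  have [n6|n6] := ltnP 6 n; first by case: (bh n h on n6).
  have [n3|n5] : n = 3 \/ n = 5 by lia.
    subst n; have := om [set h 0; h 1; h 2] (subsetT _).
    have h01 : h 0 -- h 1 by rewrite -[1]/(0 + 1) hh.
    have h02 : h 0 -- h 2 by rewrite -[2]/(0 + 2) hh.
    have h12 : h 1 -- h 2 by rewrite -[2]/(1 + 1) hh.
    have [n01 n02 n12] := And3 (adj_neq h01) (adj_neq h02) (adj_neq h12).
    rewrite setUC cardsU1 cards2 !inE ![h 2 == _]eq_sym negb_or n01 n02 n12 => h3.
    suff : 3 <= q by lia.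
    apply: h3; apply/cliqueP => a b; rewrite !inE.
    by move=> /or3P[]/eqP-> /or3P[]/eqP->; rewrite ?eqxx // => _; first [assumption|rewrite sadj_sym].
  subst n; have ha i j : i <= j -> j - i < 5 -> h i -- h j = (j - i == 1) || (j - i == 4).
    by move=> ij ji; rewrite -{1}(subnKC ij) hh.
  by apply: (tp (h 0) (h 1) (h 2) (h 3) (h 4)); first [by rewrite ha|by rewrite sadj_sym ha].
have mst := minimal_star_connected IH om nocol; have mco := minimal_coconnected IH om nocol.
have [a2|[[c cP]|[x [f [y dx]]]]] := dichotomy tb tc tp mst mco.
- have [[n [h [on n2 hH]]]|[c cP]] := odd_hole_or_bipartite (@coadj_sym G) (@coadj_irr G);
    last exact: (minimal_cobipartite IH om nocol cP).
  have [n6|n6] := ltnP 6 n; first exact: (bah n h on n6).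
  have [hn hi hh] := hH.
  have [n3|n5] : n = 3 \/ n = 5 by lia.
    subst n; have := hh 0 1 isT; have := hh 0 2 isT; have := hh 1 1 isT; rewrite /=.
    move=> /andP[n12 h12] /andP[n02 h02] /andP[n01 h01].
    by have := a2 _ _ _ n01 n02 n12 h01 h02; rewrite (negbTE h12).
  subst n; have ha i j : i < j -> j - i < 5 -> h i -- h j = (j - i == 2) || (j - i == 3).
    move=> ij ji; have := hh i _ ji; rewrite /coadj hi // (subnKC (ltnW ij)).
    move: ij ji; case: (j - i) (subn_gt0 i j) => [|[|[|[|[|]]]]] //= <- // _ _;
      by case: (_ -- _).
  (* Read in steps of two, a pentagon of the complement is a pentagon of [G]. *)
  by apply: (tp (h 0) (h 2) (h 4) (h 1) (h 3)); first [by rewrite ha|by rewrite sadj_sym ha].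
- by apply: (bip c cP); lia.
- exact: (minimal_degree IH om nocol q2 dx).
Qed.

(** * Vertices around a hole *)

Section Attachment.
Variable G : sgraph.
Hypothesis tG : tame G.

Section Outside.
Variables (n : nat) (h : nat -> G).
Hypotheses (n7 : 6 < n) (hh : hole (@sadj G) n h).
Variable v : G.
Hypothesis vC : forall i, v != h i.

Lemma hadj i j : i <= j -> j - i < n -> h i -- h j = (j - i == 1) || (j - i == n.-1).
Proof. by case: hh => _ _ h3 ij ji; rewrite -{1}(subnKC ij) h3. Qed.

Lemma hadjN i j : i < j -> j - i < n -> j - i != 1 -> j - i != n.-1 -> ~~ h i -- h j.
Proof. by move=> ij ji /negbTE n1 /negbTE n2; rewrite hadj ?(ltnW ij) // n1 n2. Qed.

Lemma hadjN' i j : i < j -> j - i < n -> j - i != 1 -> j - i != n.-1 -> ~~ h j -- h i.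
Proof. by move=> *; rewrite sadj_sym; apply: hadjN. Qed.

Lemma hsucc i j : j = i.+1 -> h i -- h j.
Proof. by move=> ->; rewrite hadj; lia. Qed.

Lemma hsucc' i j : j = i.+1 -> h j -- h i.
Proof. by move=> E; rewrite sadj_sym; apply: hsucc. Qed.

Lemma hper i : h (i + n) = h i.
Proof. by case: hh. Qed.

Ltac qlia := first [by clear -n7; lia | lia].
Ltac side := match goal with
  | |- is_true (h _ -- h _) => first [apply: hsucc; by clear; lia | apply: hsucc'; by clear; lia]
  | |- is_true (~~ h _ -- h _) => first [apply: hadjN; qlia | apply: hadjN'; qlia]
  | |- _ => first [ adj | exact: vC | by rewrite eq_sym; exact: vC ]
  end.

(** If [v] missed both hole neighbours of [h (i + 3)], chairs would force it to see [h (i + 1)],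
    [h (i + 5)] and then [h (i + 6)], which completes a bull. Length at least 7 keeps [h (i + 1)]
    and [h (i + 6)] non-adjacent. *)
Lemma attach_two j : ~~ v -- h j -> v -- h j.+1 -> v -- h j.+2.
Proof.
have [tb tc _] := tG.
(* One period is added so that the predecessors of [h j] have indices too. *)
pose i := j + n - 2.
have -> : h j = h (i + 2) by rewrite -hper; congr h; rewrite /i; lia.
have -> : h j.+1 = h (i + 3) by rewrite -hper; congr h; rewrite /i; lia.
have -> : h j.+2 = h (i + 4) by rewrite -hper; congr h; rewrite /i; lia.
move=> v2 v3; apply: contraT => v4.
have v1 : v -- h (i + 1).
  apply: contraT => v1.
  by case: (tc (h (i + 3)) v (h (i + 4)) (h (i + 2)) (h (i + 1))); side.
have v5 : v -- h (i + 5).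
  apply: contraT => v5.
  by case: (tc (h (i + 3)) v (h (i + 2)) (h (i + 4)) (h (i + 5))); side.
have n13 : h (i + 3) != h (i + 1).
  by apply: (@neq_adj _ _ _ (h (i + 4))); side.
have v6 : v -- h (i + 6).
  apply: contraT => v6.
  by case: (tc v (h (i + 3)) (h (i + 1)) (h (i + 5)) (h (i + 6))); side.
by case: (tb (h (i + 5)) v (h (i + 6)) (h (i + 4)) (h (i + 1))); side.
Qed.

Lemma attach_run i : ~~ v -- h i -> v -- h i.+1 ->
  forall a, 0 < a <= n -> v -- h (i + a) = (a <= 3).
Proof.
have [tb tc _] := tG.
move=> v0 v1; have v2 := attach_two v0 v1.
have v3 : v -- h (i.+3).
  apply: contraT => v3.
  by case: (tb (h i.+1) (h i.+2) v (h i) (h i.+3)); side.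
have vfar a : 3 < a < n.-1 -> ~~ v -- h (i + a).
  move=> /andP[a3 an]; apply/negP => va.
  by case: (tb (h i.+1) v (h i.+2) (h i) (h (i + a))); side.
have v4 := vfar 4 ltac:(lia).
have vn : ~~ v -- h (i + n.-1).
  apply/negP => va.
  by case: (tb (h i.+3) v (h i.+2) (h (i + 4)) (h (i + n.-1))); side.
move=> a /andP[a0 an]; have [a3|a3] := leqP a 3.
  by move: a0 a3; case: a an => [|[|[|[|a]]]] // _ _ _; rewrite -addSnnS ?addSnnS ?addnS addn0.
have [lt|ge] := ltnP a n.-1; first by apply/negbTE/vfar; rewrite a3.
have [->|->] : a = n.-1 \/ a = n by lia.
  exact/negbTE.
by rewrite hper; apply/negbTE.
Qed.

End Outside.

(* [v] sees the hole as a twin of [h i]; the value at [h i] itself is left open *)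
Definition cls n (h : nat -> G) (i : nat) : {set G} :=
  [set v | [forall a : 'I_n, (0 < a) ==> (v -- h (i + a) == ((a == 1 :> nat) || (a == n.-1 :> nat)))]].

Lemma clsP n h i v : reflect (forall a, 0 < a < n -> v -- h (i + a) = (a == 1) || (a == n.-1))
  (v \in cls n h i).
Proof.
rewrite inE; apply: (iffP forallP) => [H a /andP[a0 an]|H a].
  by have := H (Ordinal an); rewrite /= a0 => /eqP.
by apply/implyP => a0; apply/eqP/H; rewrite a0 /=.
Qed.

Section Classes.
Variables (n : nat) (h : nat -> G).
Hypotheses (n7 : 6 < n) (hh : hole (@sadj G) n h).

Let hp : forall i, h (i + n) = h i. Proof. by case: hh. Qed.

Lemma hmod i : h (i %% n) = h i.
Proof. exact: periodic_mod. Qed.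

Lemma cls_mod i : cls n h (i %% n) = cls n h i.
Proof.
apply/setP => v; apply/clsP/clsP => H a an; rewrite -(H a an) -hmod.
  by rewrite -(hmod (i %% n + a)) modnDml.
by rewrite -(hmod (i + a)) modnDml.
Qed.

Lemma cls_per i : cls n h (i + n) = cls n h i.
Proof. by rewrite -cls_mod modnDr cls_mod. Qed.

Lemma hole_cls i : h i \in cls n h i.
Proof. by apply/clsP => a /andP[a0 an]; case: hh => _ _ ->. Qed.

Lemma cls_notin i v a : v \in cls n h i -> 0 < a < n -> v != h (i + a).
Proof.
move=> /clsP vi /andP[a0 an]; apply/eqP => E.
have := vi a; rewrite a0 an -E sadj_irr => /(_ isT) Ea.
have up : v -- h (i + a.+1) by rewrite E (hadj hh); lia.
have dn : v -- h (i + a.-1) by rewrite E sadj_sym (hadj hh); lia.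
have := vi a.+1; have := vi a.-1; rewrite up dn; lia.
Qed.

Lemma cls_ni v i : v \in cls n h i -> v != h i -> forall j, v != h j.
Proof.
move=> vi nvi j; rewrite -(hmod j).
have jn : j %% n < n by apply: ltn_pmod; lia.
have in_ : i %% n < n by apply: ltn_pmod; lia.
have [E|ne] := eqVneq (i %% n) (j %% n); first by rewrite -E hmod.
have vi' : v \in cls n h (i %% n) by rewrite cls_mod.
have [lt|ge] := ltnP (i %% n) (j %% n).
  by rewrite -(subnKC (ltnW lt)); apply: cls_notin => //; lia.
rewrite -hp; have -> : j %% n + n = i %% n + (j %% n + n - i %% n) by lia.
by apply: cls_notin => //; lia.
Qed.

Lemma attach_cases v : [\/ forall j, v -- h j, forall j, ~~ v -- h j | exists2 i, i < n & v \in cls n h i].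
Proof.
have lt_mod i : i %% n < n by apply: ltn_pmod; lia.
have [[j E]|vC] := classic (exists j, v = h j).
  by constructor 3; exists (j %% n); rewrite // cls_mod E hole_cls.
have {}vC i : v != h i by apply/eqP => E; apply: vC; exists i.
have [[i [v0 v1]]|nostart] := classic (exists i, ~~ v -- h i /\ v -- h i.+1).
  have run := attach_run n7 hh vC v0 v1.
  constructor 3; exists (i.+2 %% n); rewrite // cls_mod; apply/clsP => a /andP[a0 an].
  have [lt|ge] := ltnP (a + 2) n.+1.
    by have -> : i.+2 + a = i + (a + 2); [lia | rewrite run; lia].
  by have -> : i.+2 + a = i + (a + 2 - n) + n; [lia | rewrite hp run; lia].
have [[j vj]|vN] := classic (exists j, ~~ v -- h j).
  constructor 2 => k; rewrite -hmod.
  have all_after m : ~~ v -- h (j + m).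
    elim: m => [|m IHm]; first by rewrite addn0.
    by apply/negP => H; apply: nostart; exists (j + m); rewrite -addnS.
  have := all_after (j * n.-1 + k); rewrite -hmod.
  have -> : j + (j * n.-1 + k) = k + j * n by rewrite addnA -mulnS prednK; [rewrite addnC|lia].
  by rewrite addnC modnMDl hmod.
by constructor 1 => j; apply: contraT => vj; case: vN; exists j.
Qed.

(** Numbered from the replaced vertex. Since this is a hole again, [attach_two] and [attach_run]
    apply to it, which reduces the adjacency of two class members to that of a vertex and a hole. *)
Definition repl i v j := if j %% n == 0 then v else h (i + j).

Lemma repl_hole i v : v \in cls n h i -> hole (@sadj G) n (repl i v).
Proof.
move=> vi; have vP := clsP _ _ _ _ vi; have vN := cls_notin vi.
have [_ hI hA] := hh.
have rp j : repl i v (j + n) = repl i v j by rewrite /repl modnDr addnA hp.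
have rm j : repl i v (j %% n) = repl i v j.
  by rewrite /repl modn_mod; case: ifP => // _; rewrite -hmod modnDmr hmod.
have r0 : repl i v 0 = v by rewrite /repl mod0n.
have rb b : 0 < b < n -> repl i v b = h (i + b).
  by move=> bn; rewrite /repl modn_small; [case: ifP => // /eqP; lia | lia].
have red j a : exists b, [/\ b < n, repl i v j = repl i v b & repl i v (j + a) = repl i v (b + a)].
  exists (j %% n); rewrite rm; split=> //; first by apply: ltn_pmod; lia.
  by rewrite -rm -(rm (j %% n + a)) modnDml.
split=> // j a an; have [b [bn -> ->]] := red j a.
  have [b0|b0] := posnP b.
    rewrite b0 add0n r0; have [->|a0] := posnP a; first by rewrite r0 eqxx.
    by rewrite rb ?a0 // (negbTE (vN _ _)) ?a0 //; lia.
  rewrite (rb b) ?b0 //; have [E|ne] := eqVneq (b + a) n.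
    have -> : repl i v (b + a) = v by rewrite E -[n]add0n rp.
    by rewrite eq_sym (negbTE (vN _ _)) ?b0 //; lia.
  have -> : repl i v (b + a) = h (i + b + a).
    rewrite -addnA; have [lt|ge] := ltnP (b + a) n; first by rewrite rb //; lia.
    have -> : b + a = (b + a - n) + n by lia.
    by rewrite rp rb ?addnA ?hp //; lia.
  exact: hI.
have [b0|b0] := posnP b.
  rewrite b0 add0n r0; have [->|a0] := posnP a; first by rewrite r0 sadj_irr; lia.
  by rewrite rb ?a0 // vP ?a0.
rewrite (rb b) ?b0 //; have [E|ne] := eqVneq (b + a) n.
  have -> : repl i v (b + a) = v by rewrite E -[n]add0n rp.
  by rewrite sadj_sym vP ?b0 //; lia.
have -> : repl i v (b + a) = h (i + b + a).
  rewrite -addnA; have [lt|ge] := ltnP (b + a) n; first by rewrite rb //; lia.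
  have -> : b + a = (b + a - n) + n by lia.
  by rewrite rp rb ?addnA ?hp //; lia.
exact: hA.
Qed.

Lemma repl0 i v : repl i v 0 = v.
Proof. by rewrite /repl mod0n. Qed.

Lemma repln i v : repl i v n = v.
Proof. by rewrite /repl modnn. Qed.

Lemma replb i v b : 0 < b < n -> repl i v b = h (i + b).
Proof. by move=> bn; rewrite /repl modn_small; [case: ifP => // /eqP; lia | lia]. Qed.

Lemma repl_ni i v u : u != v -> (forall j, u != h j) -> forall j, u != repl i v j.
Proof. by move=> uv uC j; rewrite /repl; case: ifP. Qed.

Lemma cls_same i u v : u \in cls n h i -> v \in cls n h i -> u != v -> u -- v.
Proof.
have aux u' v' : u' \in cls n h i -> v' \in cls n h i -> u' != v' -> u' != h i -> u' -- v'.
  move=> ui vi uv uh; have uC := repl_ni i uv (cls_ni ui uh); have uP := clsP _ _ _ _ ui.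
  have hr := repl_hole vi; have [rp _ _] := hr.
  apply: contraT; rewrite -{1}(repl0 i v') => H.
  have := attach_two n7 hr uC H; rewrite !replb ?uP; lia.
move=> ui vi uv; have [E|uh] := eqVneq u (h i); last exact: aux.
by rewrite sadj_sym; apply: aux; rewrite // 1?eq_sym // -E.
Qed.

Lemma cls_center i v : v \in cls n h i -> v != h i -> v -- h i.
Proof. by move=> vi; apply: cls_same (hole_cls i). Qed.

Lemma cls_next i u v : v \in cls n h i -> u \in cls n h i.+1 -> v -- u.
Proof.
move=> vi ui; rewrite sadj_sym; have vP := clsP _ _ _ _ vi; have uP := clsP _ _ _ _ ui.
have [->|uh] := eqVneq u (h i.+1); first by rewrite sadj_sym -addn1 vP //; lia.
have uv : u != v.
  apply/eqP => E; have := vP 2; rewrite -E; have := uP 1; rewrite addSnnS; lia.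
have uC := repl_ni i uv (cls_ni ui uh); have hr := repl_hole vi.
apply: contraT; rewrite -{1}(repl0 i v) => H.
have H1 : u -- repl i v 1 by rewrite replb ?addn1; [apply: cls_center|lia].
have := attach_run n7 hr uC H H1 (a := 3); rewrite add0n replb; last lia.
by have := uP 2; rewrite addSnnS; lia.
Qed.

Lemma cls_far i a u v : v \in cls n h i -> u \in cls n h (i + a) -> 1 < a < n.-1 -> ~~ v -- u.
Proof.
move=> vi ui an; rewrite sadj_sym; have vP := clsP _ _ _ _ vi; have uP := clsP _ _ _ _ ui.
have [->|uh] := eqVneq u (h (i + a)); first by rewrite sadj_sym vP //; lia.
have ua := cls_center ui uh; have hr := repl_hole vi; have [rp _ _] := hr.
have uP' b : 0 < b < n -> u -- repl i v b = (b == a) || (b == a.+1) || (b == a.-1).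
  move=> bn; rewrite replb //; have [->|ne] := eqVneq b a; first by rewrite ua.
  have [lt|ge] := ltnP a b.
    by have -> : i + b = i + a + (b - a); [lia | rewrite uP; lia].
  by rewrite -hp; have -> : i + b + n = i + a + (b + n - a); [lia | rewrite uP; lia].
have uv : u != v.
  apply/eqP => E; have := vP a.+1; have := uP' a.+1; have := vP a.-1; have := uP' a.-1.
  by rewrite !replb ?E; lia.
have uC := repl_ni i uv (cls_ni ui uh).
apply/negP => H.
(* If [a = 2], seeing [v] would extend the run of [u] to four vertices; for larger [a] the run
   starts at [a.-1] and ends before it comes back to [v]. *)
have [a2|a2] := leqP a 2.
  have H0 : ~~ u -- repl i v n.-1 by rewrite uP'; lia.
  have H1 : u -- repl i v n.-1.+1 by rewrite prednK ?repln //; lia.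
  have := attach_run n7 hr uC H0 H1 (a := 4).
  by have -> : n.-1 + 4 = 3 + n; [lia | rewrite rp uP'; lia].
have H0 : ~~ u -- repl i v (a - 2) by rewrite uP'; lia.
have H1 : u -- repl i v (a - 2).+1 by rewrite uP'; lia.
have := attach_run n7 hr uC H0 H1 (a := n - a + 2).
have -> : a - 2 + (n - a + 2) = n by lia.
by rewrite repln H; lia.
Qed.

Lemma all_cls b i v : (forall j, b -- h j) -> v \in cls n h i -> b -- v.
Proof.
move=> bA vi; have hr := repl_hole vi; have vP := clsP _ _ _ _ vi.
have bh j : b != h j by apply/adj_neq.
have bv : b != v by apply/eqP => E; have := vP 2; rewrite -E bA; lia.
apply: contraT; rewrite -{1}(repl0 i v) => H.
have H1 : b -- repl i v 1 by rewrite replb //; lia.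
have := attach_run n7 hr (repl_ni i bv bh) H H1 (a := 4).
by rewrite add0n replb ?bA; lia.
Qed.

Lemma none_cls b i v : (forall j, ~~ b -- h j) -> v \in cls n h i -> ~~ b -- v.
Proof.
move=> bA vi; have hr := repl_hole vi; have vP := clsP _ _ _ _ vi; have [rp _ _] := hr.
have bh j : b != h j.
  by apply/eqP => E; have := bA j.+1; rewrite E (hadj hh) ?subSnn; lia.
have bv : b != v by apply/eqP => E; have := vP 1; have := bA (i + 1); rewrite -E; lia.
apply/negP; rewrite -{1}(repln i v) => H1.
have H : ~~ b -- repl i v n.-1 by rewrite replb //; lia.
rewrite -{1}(@prednK n) in H1; last lia.
have := attach_run n7 hr (repl_ni i bv bh) H H1 (a := 2).
by have -> : n.-1 + 2 = 1 + n; [lia | rewrite rp replb ?(negbTE (bA _)); lia].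
Qed.

Lemma cls_uniq v i j : i < n -> j < n -> v \in cls n h i -> v \in cls n h j -> i = j.
Proof.
have aux i' j' : i' < j' -> j' < n -> v \in cls n h i' -> v \in cls n h j' -> False.
  move=> ij jn vi vj; have vP := clsP _ _ _ _ vi; have uP := clsP _ _ _ _ vj.
  pose a := j' - i'.
  have h1 : v -- h (i' + a.+1) by have -> : i' + a.+1 = j' + 1; [lia | rewrite uP; lia].
  have h2 : v -- h (i' + a.-1).
    by rewrite -hp; have -> : i' + a.-1 + n = j' + n.-1; [lia | rewrite uP; lia].
  by have := vP a.+1; have := vP a.-1; rewrite h1 h2; lia.
move=> i_n j_n vi vj; have [lt|gt|//] := ltngtP i j.
  by case: (aux i j).
by case: (aux j i).
Qed.

End Classes.
End Attachment.

(** * Clique expansions of odd cycles *)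

Lemma sum_shift n (f : nat -> nat) s : (forall i, f (i + n) = f i) ->
  \sum_(0 <= i < n) f (s + i) = \sum_(0 <= i < n) f i.
Proof.
move=> fp; elim: s => [//|s <-].
case: n fp => [|n] fp; first by rewrite !big_geq.
rewrite big_nat_recr //= [RHS]big_nat_recl //= addnC addn0; congr (_ + _).
  by rewrite addSnnS fp.
by apply: eq_bigr => i _; rewrite addSnnS.
Qed.

Lemma sum_odd t : \sum_(0 <= i < 2 * t + 1) odd i = t.
Proof.
elim: t => [|t IHt]; first by rewrite big_nat1.
have -> : 2 * t.+1 + 1 = (2 * t + 1).+2 by lia.
by rewrite !big_nat_recr //= IHt; lia.
Qed.

Lemma sum_two n (f : nat -> nat) i j : i < n -> j < n -> i != j ->
  f i + f j <= \sum_(0 <= k < n) f k.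
Proof.
move=> i_n j_n ij; rewrite big_mkord (bigD1 (Ordinal i_n)) //= (bigD1 (Ordinal j_n)) /=.
  by rewrite addnA leq_addr.
by rewrite -val_eqE eq_sym.
Qed.

(** * Sums around an odd cycle *)

Section CyclicSums.
Variables (t q : nat) (K : nat -> nat).
Let n := 2 * t + 1.
Hypotheses (Kp : forall i, K (i + n) = K i) (Kq : forall i, K i + K i.+1 <= q).

Definition deficit i := q - (K i + K i.+1).

Lemma deficitE i : K i + K i.+1 + deficit i = q.
Proof. by rewrite subnKC. Qed.

Lemma sum_deficit : \sum_(0 <= i < n) deficit i + 2 * \sum_(0 <= i < n) K i = q * n.
Proof.
have E : \sum_(0 <= i < n) K i.+1 = \sum_(0 <= i < n) K i by apply: (sum_shift 1).
rewrite mul2n -addnn -{2}E addnC -!big_split /=.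
under eq_bigr => i _ do rewrite deficitE.
by rewrite sum_nat_const_nat subn0 mulnC.
Qed.

End CyclicSums.

Section Position.
Variables (n c : nat).
Hypotheses (n0 : 0 < n) (cn : c < n).

(* distance from [c.+1] to [j] along the cycle, so that [c] comes last *)
Definition cpos j := (j + (n - c.+1)) %% n.

Lemma cpos_per j : cpos (j + n) = cpos j.
Proof. by rewrite /cpos addnAC modnDr. Qed.

Lemma cpos_lt j : cpos j < n. Proof. exact: ltn_pmod. Qed.

Lemma cpos_succ j : cpos j < n.-1 -> cpos j.+1 = (cpos j).+1.
Proof.
rewrite /cpos addSn => lt; rewrite -addn1 -modnDml addn1 modn_small //; lia.
Qed.

Lemma cpos_wrap j : cpos j = n.-1 -> cpos j.+1 = 0.
Proof. by rewrite /cpos addSn => E; rewrite -addn1 -modnDml E addn1 prednK // modnn. Qed.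

Lemma cpos_last (T : Type) (f : nat -> T) j : (forall i, f (i + n) = f i) ->
  cpos j = n.-1 -> f j = f c.
Proof.
move=> fp E; rewrite -(fp j) -(periodic_mod (j + n) fp).
have -> : (j + n) %% n = c; last by [].
have -> : j + n = j + (n - c.+1) + c.+1 by lia.
rewrite -modnDml -/(cpos j) E; have -> : n.-1 + c.+1 = c + n by lia.
by rewrite modnDr modn_small.
Qed.

End Position.

Lemma sum_cpos t c : c < 2 * t + 1 -> \sum_(0 <= j < 2 * t + 1) odd (cpos (2 * t + 1) c j) = t.
Proof.
set n := 2 * t + 1 => cn; rewrite -[RHS]sum_odd -/n.
rewrite -(@sum_shift n (fun j => nat_of_bool (odd (cpos n c j))) c.+1); last first.
  by move=> i; rewrite cpos_per.
apply: eq_big_nat => i /andP[_ i_n]; congr (nat_of_bool (odd _)); rewrite /cpos.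
have -> : c.+1 + i + (n - c.+1) = i + n by lia.
by rewrite modnDr modn_small.
Qed.

Definition cyclic_coloring n q (K : nat -> nat) (F : nat -> seq nat) :=
  [/\ forall i, F (i + n) = F i, forall i, uniq (F i), forall i, size (F i) = K i,
      forall i, all (fun x => x < q) (F i) & forall i x, x \in F i -> x \notin F i.+1].

Lemma cyclic_coloring_ex t q (K : nat -> nat) : let n := 2 * t + 1 in
  (forall i, K (i + n) = K i) -> (forall i, K i + K i.+1 <= q) ->
  \sum_(0 <= i < n) K i <= q * t -> exists F, cyclic_coloring n q K F.
Proof.
move=> n; elim: q K => [|q IHq] K Kp Kq Ks.
  by exists (fun=> [::]); split=> //= i; have := Kq i; lia.
have n0 : 0 < n by rewrite /n addn1.
have Km i : K (i %% n) = K i by apply: periodic_mod.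
have [[c0 Kc0]|Kpos] := classic (exists i, K i = 0).
  (* An empty position cuts the cycle open into a path, along which the colors are taken alternately
     from the lower and the upper end of the palette. *)
  pose c := c0 %% n; have cn : c < n by apply: ltn_pmod.
  have Kc : K c = 0 by rewrite Km.
  pose p := cpos n c.
  exists (fun j => if odd (p j) then iota (q.+1 - K j) (K j) else iota 0 (K j)).
  split=> [i|i|i|i|i x].
  - by rewrite /p cpos_per Kp.
  - by case: ifP => _; apply: iota_uniq.
  - by case: ifP => _; rewrite size_iota.
  - have Ki := Kq i.
    by case: ifP => _; apply/allP => x; rewrite mem_iota; lia.
  - have Ki := Kq i; have [E|ne] := eqVneq (p i) n.-1.
      by have -> : K i = 0; [rewrite (cpos_last n0 cn Kp E)|case: ifP].
    have lt : p i < n.-1 by have := cpos_lt c n0 i; rewrite -/(p i); lia.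
    rewrite /p (cpos_succ n0 cn lt) -/(p i) /=.
    by case: (odd (p i)); rewrite /= !mem_iota; lia.
(* Give color [q] to every second position, starting after a pair of total
   size at most [q]. *)
have K1 i : 0 < K i by rewrite lt0n; apply/eqP => E; apply: Kpos; exists i.
(* If all pairs had total [q.+1], twice the sum would be [q.+1 * (2 * t + 1)], which exceeds
   [2 * (q.+1 * t)]. *)
have [c0 dc0] : exists i, K i + K i.+1 <= q.
  apply: NNPP => nd; have := sum_deficit Kp Kq; rewrite -/n big1 ?add0n.
    by move=> E; have : q.+1 * n <= 2 * (q.+1 * t) by [rewrite -E leq_mul2l|]; rewrite /n; nia.
  by move=> i _; rewrite /deficit; apply/eqP; rewrite subn_eq0 ltnNge; apply/negP => H; apply: nd; exists i.
pose c := c0 %% n; have cn : c < n by apply: ltn_pmod.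
have dc : K c + K c.+1 <= q.
  have -> : K c.+1 = K c0.+1 by rewrite -(Km c.+1) -(Km c0.+1) -addn1 modnDml addn1.
  by rewrite Km.
(* The odd positions lose a vertex. As [c] and [c.+1] have the even positions [2 * t] and 0, their
   pair loses nothing, and this is why its total had to be at most [q] beforehand. *)
pose p := cpos n c; pose K' j := K j - odd (p j).
have KK j : K j = K' j + odd (p j) by rewrite /K'; have := K1 j; case: (odd _); lia.
have [|i||F [F1 F2 F3 F4 F5]] := IHq K'.
- by move=> i; rewrite /K' /p cpos_per Kp.
- have [E|ne] := eqVneq (p i) n.-1.
    have : K i + K i.+1 <= q.
      rewrite (cpos_last n0 cn Kp E); have -> // : K i.+1 = K c.+1.
      by apply: (cpos_last (f := fun i => K i.+1) n0 cn _ E) => j; rewrite -addSn Kp.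
    by rewrite /K'; lia.
  have lt : p i < n.-1 by have := cpos_lt c n0 i; rewrite -/(p i); lia.
  have E : p i.+1 = (p i).+1 by apply: cpos_succ.
  by have := Kq i; have := KK i; have := KK i.+1; rewrite E /=; case: (odd (p i)) => /=; lia.
- have : \sum_(0 <= j < n) K j = \sum_(0 <= j < n) K' j + t.
    by rewrite -[in RHS](sum_cpos cn) -big_split /=; apply: eq_bigr => j _; apply: KK.
  by lia.
exists (fun j => if odd (p j) then q :: F j else F j).
have qF j : q \notin F j by apply/negP => /(allP (F4 j)); rewrite ltnn.
split=> [i|i|i|i|i x].
- by rewrite /p cpos_per F1.
- by case: ifP => _ /=; rewrite ?qF F2.
- by rewrite KK -F3; case: (odd _) => /=; lia.
- have H : all (fun x => x < q.+1) (F i) by apply: sub_all (F4 i) => y; lia.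
  by case: ifP => _ //=; rewrite ltnSn.
- have xF := F5 i x; have [E|ne] := eqVneq (p i) n.-1.
    rewrite E /p (cpos_wrap n0 E) /=; have -> : odd n.-1 = false by rewrite /n; lia.
    exact: xF.
  have lt : p i < n.-1 by have := cpos_lt c n0 i; rewrite -/(p i); lia.
  have E : p i.+1 = (p i).+1 by apply: cpos_succ.
  rewrite E /=; case: (odd (p i)) => /=; rewrite inE.
    by case/orP => [/eqP->|/xF].
  move=> xi; rewrite negb_or xF // andbT; apply: contraTneq xi => ->; exact: qF.
Qed.

(** * Clique sizes just beyond the bound *)

Section Patterns.
Variable t : nat.
Let n := 2 * t + 1.

Definition tight q (K : nat -> nat) :=
  [/\ forall i, K (i + n) = K i, forall i, 0 < K i, forall i, K i + K i.+1 <= q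
    & q * t < \sum_(0 <= i < n) K i].

Lemma tight_shift q K s : tight q K -> tight q (fun i => K (s + i)).
Proof.
move=> [Kp K1 Kq Ks]; split=> [i|i|i|].
- by rewrite addnA Kp.
- exact: K1.
- by rewrite addnS Kq.
- by rewrite sum_shift.
Qed.

(* So at most one pair (for [q = 3]) or two pairs (for [q = 4]) have a sum below [q]. *)
Lemma tight_deficit q K : tight q K -> \sum_(0 <= i < n) deficit q K i + 2 <= q.
Proof.
move=> [Kp K1 Kq]; have := sum_deficit Kp Kq; rewrite -/n.
set S := \sum_(0 <= i < n) K i; set D := \sum_(0 <= i < n) _; clearbody S D.
by rewrite /n mulnDr mulnCA => E Ks; lia.
Qed.

Lemma tight_two q K i j : tight q K -> i < n -> j < n -> i != j ->
  deficit q K i + deficit q K j + 2 <= q.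
Proof.
move=> T i_n j_n ij; have := tight_deficit T; have := sum_two (deficit q K) i_n j_n ij; lia.
Qed.

Lemma tight_last q K j : tight q K -> j < n.-1 -> deficit q K j + deficit q K n.-1 + 2 <= q.
Proof. by move=> T jn; apply: tight_two => //; move: jn; rewrite /n; lia. Qed.

(** The total deficit is at most 1, and it is not 0 because [3 * n] is odd. Cut open inside the
    deficient pair, the cycle has the sizes 1, 2, 1, ..., 2, 1. *)
Lemma tight3 K : tight 3 K -> exists s, forall i, i < n -> (odd i).+1 <= K (s + i).
Proof.
move=> T0; have [[s ds]|nd] := classic (exists s, 0 < deficit 3 K s); last first.
  have [Kp _ Kq _] := T0; have := sum_deficit Kp Kq; rewrite -/n big1; first by rewrite /n => E; exfalso; lia.
  by move=> i _; apply/eqP; rewrite -leqn0 leqNgt; apply/negP => d; apply: nd; exists i.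
exists s.+1 => i; set K' := fun i => K (s.+1 + i); have T : tight 3 K' by apply: tight_shift.
have dl : 0 < deficit 3 K' n.-1.
  rewrite /deficit /K'; have -> : s.+1 + n.-1 = s + n by rewrite /n; lia.
  by have -> : s.+1 + n.-1.+1 = s.+1 + n; [rewrite /n; lia | have [Kp _ _ _] := T0; rewrite !Kp].
have d0 j : j < n.-1 -> deficit 3 K' j = 0.
  by move=> jn; have := tight_last T jn; lia.
have [Kp K1 Kq _] := T.
have K0 : K' 0 = 1.
  have := deficitE Kq n.-1; have -> : n.-1.+1 = 0 + n by rewrite /n; lia.
  by rewrite Kp; have := K1 n.-1; have := K1 0; lia.
rewrite -/(K' i); suff : i < n -> K' i = (odd i).+1 by move=> H /H->.
elim: i => [|i IHi] i_n; first by rewrite K0.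
have := deficitE Kq i; rewrite d0 ?IHi //=; try lia.
Qed.

Lemma size_alternating m : size (alternating13 m) = 2 * m + 1.
Proof. by rewrite /alternating13; elim: m => //= m IHm; lia. Qed.

Lemma nth_alternating m i : i < 2 * m + 1 -> nth 0 (alternating13 m) i = if odd i then 3 else 1.
Proof.
elim: m i => [|m IHm] [|[|i]] // im; rewrite -[alternating13 m.+1]/[:: 1, 3 & alternating13 m] /=.
rewrite negbK; apply: IHm; lia.
Qed.

Lemma twos_pattern a m : ~~ odd a -> a + (2 * m + 1) = n -> 0 < t -> let ks := nseq a 2 ++ alternating13 m in
  size ks = n /\ (twos_then_alternating ks \/ twos_then_one t ks).
Proof.
move=> ea E t0 ks; split; first by rewrite size_cat size_nseq size_alternating.
have [m0|m0] := posnP m; last by left; exists a, m.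
right; rewrite /twos_then_one /ks m0 cats1; congr (rcons (nseq _ 2) 1); move: E; rewrite /n m0; lia.
Qed.

(** The total deficit is at most 2. If one pair has it all, cutting there gives 1, 3, 1, ..., 3, 1.
    Otherwise the cut is made between a 1 and a following 2; where these never meet, no clique is a
    single vertex. *)
Lemma tight4 K : 0 < t -> tight 4 K -> exists s ks, [/\ size ks = n,
  twos_then_alternating ks \/ twos_then_one t ks & forall i, i < n -> nth 0 ks i <= K (s + i)].
Proof.
move=> t0 T0.
have last s : let K' := fun i => K (s.+1 + i) in deficit 4 K' n.-1 = deficit 4 K s.
  rewrite /= /deficit; have -> : s.+1 + n.-1 = s + n by rewrite /n; lia.
  by have -> : s.+1 + n.-1.+1 = s.+1 + n; [rewrite /n; lia | have [Kp _ _ _] := T0; rewrite !Kp].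
have [[s ds]|nd2] := classic (exists s, 1 < deficit 4 K s).
  exists s.+1; set K' := fun i => K (s.+1 + i); have T : tight 4 K' by apply: tight_shift.
  have [Kp K1 Kq _] := T; have := last s; rewrite -/K' => dl.
  have d0 j : j < n.-1 -> deficit 4 K' j = 0.
    by move=> jn; have := tight_last T jn; lia.
  have K0 : K' 0 = 1.
    have := deficitE Kq n.-1; have -> : n.-1.+1 = 0 + n by rewrite /n; lia.
    by rewrite Kp; have := K1 n.-1; have := K1 0; lia.
  have [sz pat] := @twos_pattern 0 t isT erefl t0.
  exists (nseq 0 2 ++ alternating13 t); split=> // i i_n.
  rewrite /= nth_alternating // -/(K' i).
  suff -> : K' i = if odd i then 3 else 1 by [].
  elim: i i_n => [|i IHi] i_n; first by rewrite K0.
  have := deficitE Kq i; rewrite d0 ?IHi //=; try lia.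
  by case: (odd i) => /=; lia.
have [[s [Ks Ks1]]|n12] := classic (exists s, K s = 1 /\ K s.+1 = 2).
  exists s.+1; set K' := fun i => K (s.+1 + i); have T : tight 4 K' by apply: tight_shift.
  have [Kp K1 Kq _] := T; have := last s; rewrite -/K' => dl.
  have dl1 : deficit 4 K' n.-1 = 1 by rewrite dl /deficit Ks Ks1.
  have K0 : K' 0 = 2 by rewrite /K' addn0.
  have Kl : K' n.-1 = 1.
    by rewrite /K'; have -> : s.+1 + n.-1 = s + n; [rewrite /n; lia | have [-> _ _ _] := T0].
  (* The first size other than 2 is [K' a = 1]. The pairs starting at [a.-1] and [n.-1] use up both
     units of deficit, so the sizes alternate from [a] on; that they end with 1 makes [a] even. *)
  have exj : exists j, (j < n) && (K' j != 2).
    by exists n.-1; rewrite Kl andbT /n; lia.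
  case: (ex_minnP exj) => a /andP[an Ka] amin.
  have K2 j : j < a -> K' j = 2.
    move=> ja; apply/eqP; apply: contraT => Kj; have := amin j; rewrite Kj (ltn_trans ja an) /=.
    by move=> /(_ isT); lia.
  have a0 : 0 < a by case: a Ka {amin K2 an} => //; rewrite K0.
  have Ka1 : K' a = 1.
    by have := Kq a.-1; rewrite prednK // K2 ?prednK //; have := K1 a; lia.
  have da : deficit 4 K' a.-1 = 1.
    by rewrite /deficit prednK // K2 ?prednK // Ka1.
  have alt i : a + i < n -> K' (a + i) = if odd i then 3 else 1.
    elim: i => [|i IHi] ain; first by rewrite addn0 Ka1.
    have d0 : deficit 4 K' (a + i) = 0.
      have h := tight_deficit T.
      apply/eqP; rewrite -leqn0 leqNgt; apply/negP => dp.
      move: h; rewrite big_mkord.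
      have l1 : a.-1 < n by lia. have l2 : a + i < n by lia. have l3 : n.-1 < n by lia.
      rewrite (bigD1 (Ordinal l1)) //= (bigD1 (Ordinal l2)) /=; last by rewrite -val_eqE /=; lia.
      rewrite (bigD1 (Ordinal l3)) /=; last by rewrite -!val_eqE /=; lia.
      by lia.
    have := deficitE Kq (a + i); rewrite d0 -addnS IHi; last lia.
    by rewrite /=; case: (odd i) => /=; lia.
  have odd_na : ~~ odd (n.-1 - a).
    by have := alt (n.-1 - a); rewrite subnKC ?Kl; [case: (odd _) => //; lia | lia].
  pose m := (n.-1 - a)./2.
  have Em : a + (2 * m + 1) = n by rewrite /m /n; rewrite /n in odd_na an *; lia.
  have ea : ~~ odd a by rewrite /n in odd_na an; lia.
  have [sz pat] := twos_pattern ea Em t0.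
  exists (nseq a 2 ++ alternating13 m); split=> // i i_n; rewrite -/(K' i).
  rewrite nth_cat size_nseq; case: ltnP => [ia|ai]; first by rewrite nth_nseq ia K2.
  rewrite nth_alternating; last lia.
  by rewrite -[i in K' i](subnKC ai) alt // subnKC.
have [Kp K1 Kq _] := T0.
(* Now a 1 is followed by 3 and then by 1 again, which cannot close up around an odd cycle. *)
have no1 i : K i != 1.
  apply/eqP => Ki.
  have step j : K j = 1 -> K j.+1 = 3 /\ K j.+2 = 1.
    move=> Kj; have d1 : deficit 4 K j <= 1 by rewrite leqNgt; apply/negP => d; apply: nd2; exists j.
    have K2 : K j.+1 != 2 by apply/eqP => E; apply: n12; exists j.
    by have := deficitE Kq j; have := Kq j; have := Kq j.+1; have := K1 j.+1; have := K1 j.+2; lia.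
  have all m : K (i + 2 * m) = 1.
    elim: m => [|m /step[_]]; first by rewrite addn0.
    by have -> : i + 2 * m.+1 = (i + 2 * m).+2 by lia.
  have [] := step _ (all t); have -> : (i + 2 * t).+1 = i + n by rewrite /n; lia.
  by rewrite Kp Ki.
have [sz pat] := @twos_pattern (2 * t) 0 ltac:(lia) erefl t0.
exists 0, (nseq (2 * t) 2 ++ alternating13 0); split=> // i i_n.
rewrite nth_cat size_nseq add0n; case: ltnP => [it|ti].
  by rewrite nth_nseq it; have := no1 i; have := K1 i; lia.
by have -> : i = 2 * t; [rewrite /n in i_n; lia | rewrite subnn /= K1].
Qed.

End Patterns.

(** * Embeddings of joins, cycles and small cliques *)

Definition embedding (H G : sgraph) (f : H -> G) :=
  injective f /\ forall x y : H, x -- y -> f x -- f y.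

Lemma contains_join (G H1 H2 : sgraph) (f : H1 -> G) (g : H2 -> G) :
  embedding f -> embedding g -> (forall x y, f x -- g y) -> contains G (join H1 H2).
Proof.
move=> [fI fH] [gI gH] fg.
have fgn x y : f x != g y by apply: adj_neq.
exists (fun u => match u with inl x => f x | inr y => g y end); split.
  move=> [x|x] [y|y] E; first by rewrite (fI _ _ E).
  - by have := fgn x y; rewrite E eqxx.
  - by have := fgn y x; rewrite E eqxx.
  - by rewrite (gI _ _ E).
move=> [x|x] [y|y] /andP[_]; rewrite ?orbT => H; last first.
- by apply: gH; move: H; rewrite (sadj_sym y) orbb.
- by rewrite sadj_sym.
- by [].
- by apply: fH; move: H; rewrite (sadj_sym y) orbb.
Qed.

Lemma embedding_graph_of (T : finType) (r : rel T) (G : sgraph) (f : T -> G) :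
  injective f -> (forall x y, x != y -> r x y -> f x -- f y) -> @embedding (graph_of r) G f.
Proof.
move=> fI fr; split=> // x y /andP[nxy /orP[|]]; first exact: fr.
by rewrite sadj_sym => rxy; apply: fr; rewrite // eq_sym.
Qed.

Lemma embedding_vertex (G : sgraph) (b : G) : @embedding (complete 1) G (fun=> b).
Proof.
apply: embedding_graph_of => [x y _|x y]; first by rewrite (ord1 x) (ord1 y).
by rewrite (ord1 x) (ord1 y) eqxx.
Qed.

Lemma embedding_edge (G : sgraph) (b b' : G) : b -- b' ->
  @embedding (complete 2) G (fun i => if val i == 0 then b else b').
Proof.
move=> bb; have nb := adj_neq bb.
apply: embedding_graph_of => [[[|[|x]] hx] [[|[|y]] hy]|[[|[|x]] hx] [[|[|y]] hy]] //=.
- by move=> _; apply: val_inj.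
- by move=> E; rewrite E eqxx in nb.
- by move=> E; rewrite E eqxx in nb.
- by move=> _; apply: val_inj.
- by rewrite sadj_sym.
Qed.

Lemma embedding_hole (G : sgraph) n (h : nat -> G) : 2 < n -> hole (@sadj G) n h ->
  @embedding (cycle_graph n) G (fun i => h i).
Proof.
move=> n2 [hp hI hA].
apply: embedding_graph_of => [x y E|x y _ /eqP->]; last first.
  rewrite /= (periodic_mod _ hp) -addn1 hA //; lia.
apply/val_inj => /=; have xn := ltn_ord x; have yn := ltn_ord y.
have [le|le] := leqP x y.
  by have := hI x (y - x); rewrite subnKC // E eqxx => /(_ ltac:(lia)); lia.
by have := hI y (x - y); rewrite (subnKC (ltnW le)) E eqxx => /(_ ltac:(lia)); lia.
Qed.

Lemma clique_contains (G H : sgraph) (K : {set G}) : clique K -> #|H| <= #|K| -> contains G H.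
Proof.
move=> /cliqueP cK HK.
pose f (x : H) := enum_val (widen_ord HK (enum_rank x)).
have fI : injective f.
  by move=> x y /enum_val_inj/(congr1 val)/= E; apply/enum_rank_inj/val_inj.
exists f; split=> // x y xy; apply: cK; rewrite ?enum_valP //.
by rewrite (inj_eq fI) adj_neq.
Qed.

(** The complete graph on five vertices is the join of [C_3] and [K_2], so (ii) also disposes of all
    large cliques. *)
Lemma clique5_contains (G : sgraph) (K : {set G}) : clique K -> 4 < #|K| ->
  contains G (join (cycle_graph (2 * 1 + 1)) (complete 2)).
Proof. by move=> cK K4; apply: (clique_contains cK); rewrite card_sum !card_ord. Qed.

(** * The expansion around an odd hole *)

Section Expansion.
Variables (G : sgraph) (t : nat) (h : nat -> G).
Let n := 2 * t + 1.
Hypotheses (tG : tame G) (n7 : 6 < n) (hh : hole (@sadj G) n h).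
Local Notation cl := (cls n h).
Local Notation K := (fun i => #|cl i|).

Definition body : {set G} := [set v | [exists i : 'I_n, v \in cl i]].

Lemma bodyP v : reflect (exists2 i, i < n & v \in cl i) (v \in body).
Proof.
rewrite inE; apply: (iffP existsP) => [[i vi]|[i i_n vi]]; first by exists i.
by exists (Ordinal i_n).
Qed.

Lemma cls_body i v : v \in cl i -> v \in body.
Proof.
move=> vi; apply/bodyP; exists (i %% n); last by rewrite cls_mod.
by apply: ltn_pmod; rewrite /n addn1.
Qed.

Lemma cls_adj i j u v : i < n -> j < n -> u \in cl i -> v \in cl j -> u -- v ->
  [\/ i = j, j = i.+1 %% n | i = j.+1 %% n].
Proof.
have aux i' j' u' v' : i' < j' -> j' < n -> u' \in cl i' -> v' \in cl j' -> u' -- v' ->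
    j' = i'.+1 %% n \/ i' = j'.+1 %% n.
  move=> ij jn ui vj uv; have [E|ne] := eqVneq j' i'.+1; first by left; rewrite -E modn_small.
  have [E|ne'] := eqVneq (j' - i') n.-1.
    by right; have [-> ->] : j' = n.-1 /\ i' = 0 by [lia|]; rewrite prednK ?modnn; lia.
  rewrite -(subnKC (ltnW ij)) in vj.
  by have := cls_far tG n7 hh ui vj; rewrite uv; lia.
move=> i_n j_n ui vj uv; have [lt|gt|E] := ltngtP i j.
- by case: (aux i j u v) => // E; [constructor 2|constructor 3].
- by case: (aux j i v u) => //; rewrite 1?sadj_sym // => E; [constructor 3|constructor 2].
- by constructor 1.
Qed.

Lemma body_pos : exists pos : G -> nat, forall v, v \in body -> pos v < n /\ v \in cl (pos v).
Proof.
exists (fun v => if [pick i : 'I_n | v \in cl i] is Some i then val i else 0) => v.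
rewrite inE => /existsP[i vi]; case: pickP => [j vj|/(_ i)]; last by rewrite vi.
by split; [apply: ltn_ord|].
Qed.

Lemma expansion_colset q : (forall i, #|cl i| + #|cl i.+1| <= q) ->
  \sum_(0 <= i < n) #|cl i| <= q * t -> colset body q.
Proof.
move=> Kq Ks; have n0 : 0 < n by rewrite /n addn1.
have Kp i : K (i + n) = K i by rewrite /= cls_per.
have [F [F1 F2 F3 F4 F5]] := cyclic_coloring_ex Kp Kq Ks.
have Fm i : F (i %% n) = F i by apply: periodic_mod.
have [pos posP] := body_pos.
pose c v := nth 0 (F (pos v)) (index v (enum (cl (pos v)))).
have idx v : v \in body -> index v (enum (cl (pos v))) < size (F (pos v)).
  by move=> /posP[_ vp]; rewrite F3 cardE index_mem mem_enum.
have cF v : v \in body -> c v \in F (pos v) by move=> /idx; apply: mem_nth.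
exists c; split=> [v /cF/(allP (F4 _))//|u v uB vB uv E].
have [pu cu] := posP _ uB; have [pv cv] := posP _ vB.
have [Ep|Ep|Ep] := cls_adj pu pv cu cv uv.
- have iv := idx _ vB; rewrite -Ep in cv iv.
  move/eqP: E; rewrite /c -Ep nth_uniq ?idx // => /eqP/(congr1 (nth u (enum (cl (pos u))))).
  by rewrite !nth_index ?mem_enum // => Euv; move: uv; rewrite Euv sadj_irr.
- by have := cF _ vB; rewrite Ep Fm -E (negbTE (F5 _ _ (cF _ uB))).
- by have := cF _ uB; rewrite Ep Fm E (negbTE (F5 _ _ (cF _ vB))).
Qed.

Lemma cls_disjoint i j v : i < n -> j < n -> i != j -> v \in cl i -> v \notin cl j.
Proof.
move=> i_n j_n ij vi; apply: contra ij => vj; apply/eqP.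
exact: (cls_uniq n7 hh i_n j_n vi vj).
Qed.

Lemma clique_pair i : clique (cl i :|: cl i.+1) /\ #|cl i :|: cl i.+1| = #|cl i| + #|cl i.+1|.
Proof.
split.
  apply/cliqueP => x y /setUP[xi|xi] /setUP[yi|yi] nxy.
  - exact: (cls_same tG n7 hh xi yi nxy).
  - exact: (cls_next tG n7 hh xi yi).
  - by rewrite sadj_sym; apply: (cls_next tG n7 hh yi xi).
  - exact: (cls_same tG n7 hh xi yi nxy).
apply: cards_disjointU => z; rewrite -(cls_mod hh i) -(cls_mod hh i.+1).
have n0 : 0 < n by rewrite /n addn1.
apply: cls_disjoint; rewrite ?ltn_pmod //.
rewrite -addn1 -modnDml; have := ltn_pmod i n0; move: (i %% n) => k kn.
have [->|ne] := eqVneq k n.-1; first by rewrite addn1 prednK // modnn; lia.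
by rewrite modn_small; lia.
Qed.

(* A graph laid out along the cycle, vertex [x] being the [idx x]-th member of
   the clique number [pos x], embeds as soon as the cliques are large enough. *)
Lemma expansion_embedding (H : sgraph) s (pos idx : H -> nat) :
  (forall x, pos x < n) -> (forall x, idx x < #|cl (s + pos x)|) ->
  (forall x y, pos x = pos y -> idx x = idx y -> x = y) ->
  (forall x y, x -- y -> [\/ pos x = pos y, pos y = (pos x).+1 %% n | pos x = (pos y).+1 %% n]) ->
  exists2 f : H -> G, embedding f & forall x, f x \in body.
Proof.
move=> posn idxK inj hom.
pose f x := nth (h 0) (enum (cl (s + pos x))) (idx x).
have fcl x : f x \in cl (s + pos x) by rewrite -mem_enum mem_nth // -cardE.
have n0 : 0 < n by rewrite /n addn1.
have fI : injective f.
  move=> x y E; have Ep : pos x = pos y.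
    have := fcl x; have := fcl y; rewrite E -(cls_mod hh (s + pos x)) -(cls_mod hh (s + pos y)).
    move=> fy fx; have := cls_uniq n7 hh (ltn_pmod _ n0) (ltn_pmod _ n0) fx fy.
    by move/eqP; rewrite eqn_modDl !modn_small // => /eqP.
  apply: inj => //; move/eqP: E; rewrite /f -Ep nth_uniq ?enum_uniq -?cardE //; first by move/eqP.
  by rewrite Ep.
exists f; last by move=> x; apply: cls_body (fcl x).
have next x y : pos y = (pos x).+1 %% n -> f x -- f y.
  move=> E; apply: (cls_next tG n7 hh (fcl x)).
  by have := fcl y; rewrite E -(cls_mod hh) modnDmr addnS cls_mod.
split=> // x y xy; have [E|E|E] := hom x y xy.
- have := fcl y; rewrite -E => fy; apply: (cls_same tG n7 hh (fcl x) fy).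
  by rewrite (inj_eq fI) adj_neq.
- exact: next.
- by rewrite sadj_sym; apply: next.
Qed.

Lemma expansion_contains s ks : size ks = n -> (forall i, i < n -> nth 0 ks i <= #|cl (s + i)|) ->
  contains G (clique_expansion ks).
Proof.
move=> sz ksK.
have [||||f [fI fH] _] := @expansion_embedding (clique_expansion ks) s
  (fun u => val (tag u)) (fun u => val (tagged u)).
- by move=> x; rewrite -sz ltn_ord.
- move=> x; apply: leq_trans (ltn_ord _) _; apply: ksK; by rewrite -sz ltn_ord.
- move=> [i x] [j y] /= /val_inj E; subst j => /= /val_inj E; by subst y.
- move=> x y /andP[_].
  have E (u v : clique_expansion ks) : (tag u == tag v) || (tag v == ordS (tag u)) ->
      val (tag u) = val (tag v) \/ val (tag v) = (val (tag u)).+1 %% n.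
    by case/orP => /eqP->; [left|right; exact: (congr1 (modn _) sz)].
  case/orP => /E[]; by [constructor 1|constructor 2|constructor 3|].
by exists f.
Qed.

(** [M_{3t+1}] lies in [C_{2t+1}[1,2,1,...,2,1]]: [u_{3k}] goes to position [2k], and [u_{3k+1}],
    [u_{3k+2}] share position [2k+1]. *)
Lemma spindle_embedding s : (forall i, i < n -> (odd i).+1 <= #|cl (s + i)|) ->
  exists2 f : spindle t -> G, embedding f & forall x, f x \in body.
Proof.
move=> big.
apply: (@expansion_embedding (spindle t) s (fun u => 2 * (val u %/ 3) + (val u %% 3 != 0))
  (fun u => val u %% 3 == 2)).
- by move=> x; have := ltn_ord x; rewrite /n /=; lia.
- move=> x; have xn : 2 * (val x %/ 3) + (val x %% 3 != 0) < n by have := ltn_ord x; rewrite /n /=; lia.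
  by apply: leq_trans (big _ xn); lia.
- by move=> x y /= E1 E2; apply: val_inj => /=; lia.
move=> x y /andP[nxy].
have E (u v : 'I_(3 * t).+1) : u != v -> (v == ordS u) || [exists q : 'I_t,
      ((val u == 3 * q) && (val v == 3 * q + 2)) || ((val u == 3 * q + 1) && (val v == 3 * q + 3))] ->
    let p (w : 'I_(3 * t).+1) := 2 * (val w %/ 3) + (val w %% 3 != 0) in
    p u = p v \/ p v = (p u).+1 %% n.
  move=> nuv H p; have un := ltn_ord u; have vn := ltn_ord v.
  have nn : n = 2 * t + 1 by [].
  case/orP: H => [/eqP Ev|/existsP[k /orP[]/andP[/eqP Eu /eqP Ev]]]; last first.
  - have -> : p u = 2 * k + 1 by rewrite /p Eu; lia.
    have -> : p v = 2 * k + 2 by rewrite /p Ev; lia.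
    by right; have := ltn_ord k => kt; rewrite modn_small; lia.
  - have -> : p u = 2 * k by rewrite /p Eu; lia.
    have -> : p v = 2 * k + 1 by rewrite /p Ev; lia.
    by right; have := ltn_ord k => kt; rewrite modn_small; lia.
  have [ul|ul] := eqVneq (val u) (3 * t).
    right; have -> : p u = 2 * t by rewrite /p ul; lia.
    have -> : p v = 0 by rewrite /p Ev /= ul modnn.
    by rewrite -addn1 modnn.
  have Ev' : val v = (val u).+1 by rewrite Ev /= modn_small //; move: ul un => /=; lia.
  have [u3|u3] := eqVneq (val u %% 3) 1.
    by left; rewrite /p Ev'; lia.
  have Pv : p v = (p u).+1 by rewrite /p Ev'; lia.
  by right; rewrite Pv modn_small // nn; move: ul un; rewrite /p /=; lia.
have nyx : y != x by rewrite eq_sym.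
case/orP => [/(E _ _ nxy)|/(E _ _ nyx)] [] Exy.
- by constructor 1.
- by constructor 2.
- by constructor 1.
- by constructor 3.
Qed.

End Expansion.

(** * Odd holes *)

Definition obstruction (G : sgraph) : Prop :=
  contains G (join (compl (cycle_graph 7)) (complete 1)) \/
  (exists i : nat, 1 <= i /\
     contains G (join (cycle_graph (2 * i + 1)) (complete 2))) \/
  (exists i : nat, 1 <= i /\
     contains G (join (spindle i) (complete 1))) \/
  (exists (i : nat) (ks : seq nat),
     [/\ 1 <= i, size ks = 2 * i + 1,
         twos_then_alternating ks \/ twos_then_one i ks
       & contains G (clique_expansion ks)]).

Lemma clique5_obstruction (G : sgraph) (K : {set G}) : clique K -> 4 < #|K| -> obstruction G.
Proof. by move=> cK K4; right; left; exists 1; split=> //; apply: clique5_contains cK K4. Qed.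

Definition swap0 a x := if x == a then 0 else if x == 0 then a else x.

Lemma swap0_inj a : injective (swap0 a).
Proof. by move=> x y; rewrite /swap0; do 4?case: eqP; lia. Qed.

Section OddHoleCase.
Variables (G : sgraph) (t : nat) (h : nat -> G).
Let n := 2 * t + 1.
Hypotheses (tG : tame G) (n7 : 6 < n) (hh : hole (@sadj G) n h).
Hypothesis crit : forall A : {set G}, A != setT -> colset A 4.
Local Notation cl := (cls n h).
Local Notation A := (body t h).

Definition dominating : {set G} := [set b | [forall i : 'I_n, b -- h i]].
Local Notation B := dominating.

Lemma domP b : reflect (forall i, b -- h i) (b \in B).
Proof.
rewrite inE; apply: (iffP forallP) => [H i|H i]; last exact: H.
have i_n : i %% n < n by apply: ltn_pmod; rewrite /n addn1.
by have := H (Ordinal i_n); rewrite /= (hmod hh).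
Qed.

Lemma dom_body b v : b \in B -> v \in A -> b -- v.
Proof. by move=> /domP bB /bodyP[i _ vi]; apply: (all_cls tG n7 hh bB vi). Qed.

Lemma hole_body i : h i \in A.
Proof. by apply: (@cls_body _ _ _ hh i); apply: hole_cls hh i. Qed.

Lemma dom_notin b : b \in B -> b \notin A.
Proof. by move=> bB; apply/negP => bA; have := dom_body bB bA; rewrite sadj_irr. Qed.

Lemma far_none d : d \notin A -> d \notin B -> forall i, ~~ d -- h i.
Proof.
move=> dA dB; have [dall|//|[i i_n di]] := attach_cases tG n7 hh d.
  by case/domP: dB.
by case/negP: dA; apply/bodyP; exists i.
Qed.

Lemma far_body d v : d \notin A -> d \notin B -> v \in A -> ~~ d -- v.
Proof.
by move=> dA dB /bodyP[i _ vi]; apply: (none_cls tG n7 hh (far_none dA dB) vi).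
Qed.

(** Otherwise [b] is the centre of a chair with leaves [h 0] and [h 2] and long leg [d], [d']. *)
Lemma far_dom d d' b : d \notin A -> d \notin B -> d' \notin A -> d' \notin B ->
  b \in B -> d -- d' -> b -- d -> b -- d'.
Proof.
move=> dA dB d'A d'B bB dd bd; apply: contraT => bd'; have [_ tc _] := tG.
have n0 := far_none dA dB; have n0' := far_none d'A d'B; have bh := domP _ bB.
have h02 : ~~ h 0 -- h 2 by apply: (hadjN hh); lia.
have nh02 : h 0 != h 2.
  by have [_ hI _] := hh; have := hI 0 2; rewrite /= => ->; lia.
case: (tc b (h 0) (h 2) d d') => //; by rewrite 1?sadj_sym.
Qed.

Lemma odd_hole_case : obstruction G \/ colset [set: G] 4.
Proof.
have [[i Ki]|K4] := classic (exists i, 4 < #|cl i| + #|cl i.+1|).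
  by left; have [cK E] := clique_pair tG n7 hh i; apply: (clique5_obstruction cK); rewrite E.
have {}K4 i : #|cl i| + #|cl i.+1| <= 4.
  by rewrite leqNgt; apply/negP => H; apply: K4; exists i.
have [[b [b' [bB b'B bb]]]|Bst] := classic (exists b b', [/\ b \in B, b' \in B & b -- b']).
  left; right; left; exists t; split; first by move: n7; rewrite /n; lia.
  apply: (contains_join (embedding_hole (n:=n) _ hh) (embedding_edge bb)); first lia.
  by move=> x y; rewrite sadj_sym; case: ifP => _; apply/domP.
have Kp i : #|cl (i + n)| = #|cl i| by rewrite cls_per.
have K1 i : 0 < #|cl i| by apply/card_gt0P; exists (h i); apply: hole_cls.
have t0 : 0 < t by move: n7; rewrite /n; lia.
have [S4|S4] := ltnP (4 * t) (\sum_(0 <= i < n) #|cl i|).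
  left; do 3!right.
  have [s [ks [sz pat ksK]]] := @tight4 t (fun i => #|cl i|) t0 (And4 Kp K1 K4 S4).
  by exists t, ks; split=> //; apply: (expansion_contains tG n7 hh sz ksK).
have A4 : colset A 4 by apply: (expansion_colset tG n7 hh).
(* If [B] is empty, no edge leaves [A], and its coloring is independent of that of the rest. *)
have [[b bB]|noB] := classic (exists b, b \in B); last first.
  right; have -> : [set: G] = A :|: ~: A by rewrite setUCr.
  apply: colset_union A4 _.
    move=> x y xA; rewrite inE => yA; rewrite sadj_sym; apply: far_body => //.
    by apply/negP => yB; apply: noB; exists y.
  by apply: crit; apply: (@proper_notin _ _ (h 0)); rewrite inE negbK hole_body.
(* Next to [b], four vertices in two consecutive cliques already make a [K_5]. *)
have [[i Ki]|K3] := classic (exists i, 3 < #|cl i| + #|cl i.+1|).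
  left; have [cK E] := clique_pair tG n7 hh i.
  have inA v : v \in cl i :|: cl i.+1 -> v \in A.
    by case/setUP => [|] vi; apply: (cls_body hh vi).
  apply: (@clique5_obstruction _ (b |: (cl i :|: cl i.+1))).
    apply/cliqueP => x y; rewrite !(in_setU1 _ b) => /orP[/eqP->|xK] /orP[/eqP->|yK].
    - by rewrite eqxx.
    - by move=> _; apply: dom_body => //; apply: inA.
    - by move=> _; rewrite sadj_sym; apply: dom_body => //; apply: inA.
    - exact: (cliqueP _ cK).
  rewrite cardsU1 E; have -> /= : b \notin cl i :|: cl i.+1 by apply: contra (dom_notin bB) => /inA.
  by rewrite add1n ltnS; exact: Ki.
have {}K3 i : #|cl i| + #|cl i.+1| <= 3.
  by rewrite leqNgt; apply/negP => H; apply: K3; exists i.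
have [S3|S3] := ltnP (3 * t) (\sum_(0 <= i < n) #|cl i|).
  left; right; right; left; exists t; split=> //.
  have [s big] := @tight3 t (fun i => #|cl i|) (And4 Kp K1 K3 S3).
  have [f fE fA] := spindle_embedding tG n7 hh big.
  apply: (contains_join fE (embedding_vertex b)) => x _.
  by rewrite sadj_sym; apply: dom_body.
(* Colors 1, 2, 3 go to [A] and color 0 to [B], which is stable by [Bst]. *)
right; have [c3 [c3lt c3P]] : colset A 3 by apply: (expansion_colset tG n7 hh).
have [c [clt cP]] : colset (~: A) 4.
  by apply: crit; apply: (@proper_notin _ _ (h 0)); rewrite inE negbK hole_body.
(* Adjacent vertices outside [A] and [B] have the same neighbours in [B], so
   exchanging color 0 with the color of one such neighbour is consistent on
   them and frees color 0 for [B]. *)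
pose pk d := [pick b | (b \in B) && (b -- d)].
pose cD d := if pk d is Some b then swap0 (c b) (c d) else c d.
exists (fun u => if u \in B then 0 else if u \in A then (c3 u).+1 else cD u).
have Bc b1 : b1 \in B -> b1 \in ~: A by move=> ?; rewrite in_setC dom_notin.
split=> [u _|].
  case: ifP => // uB; case: ifP => [/c3lt//|uA].
  have cu : c u < 4 by apply: clt; rewrite inE uA.
  rewrite /cD /pk; case: pickP => // b1 /andP[b1B _]; rewrite /swap0.
  by do 2!case: ifP => // _; apply/clt/Bc.
have BD u v : u \in B -> v \notin B -> v \notin A -> u -- v -> 0 <> cD v.
  move=> uB vB vA uv; rewrite /cD /pk; case: pickP => [b1 /andP[b1B b1v]|/(_ u)]; last by rewrite uB uv.
  have vc : v \in ~: A by rewrite inE.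
  have ne := cP _ _ (Bc _ b1B) vc b1v.
  have -> : 0 = swap0 (c b1) (c b1) by rewrite /swap0 eqxx.
  by move/swap0_inj.
have AD u v : u \in A -> v \notin B -> v \notin A -> u -- v -> False.
  by move=> uA vB vA uv; have := far_body vA vB uA; rewrite sadj_sym uv.
move=> u v _ _ uv.
case: (boolP (u \in B)) => uB; case: (boolP (v \in B)) => vB.
- by case: Bst; exists u, v.
- by case: (boolP (v \in A)) => // vA; apply: BD uv.
- by case: (boolP (u \in A)) => // uA; apply/nesym/(BD v u) => //; rewrite sadj_sym.
case: (boolP (u \in A)) => uA; case: (boolP (v \in A)) => vA.
- by move=> [E]; apply: (c3P _ _ uA vA uv).
- by case: (AD u v).
- by case: (AD v u); rewrite // sadj_sym.
have ne : c u <> c v by apply: cP => //; rewrite inE.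
have Epk : pk u = pk v.
  apply: eq_pick => b1; have [b1B|//] := boolP (b1 \in B).
  by apply/idP/idP; apply: far_dom; rewrite // sadj_sym.
rewrite /cD Epk; case: (pk v) => // b1; by move/swap0_inj.
Qed.

End OddHoleCase.

(** * Odd antiholes *)

Section MatrixPatterns.
Variables (m : rel nat) (N : nat).

(* [vm_compute] evaluates the arguments of [&&] and [||] eagerly, hence the
   conditionals. *)
Fixpoint ex_below (P : pred nat) n :=
  if n is n'.+1 then if P n' then true else ex_below P n' else false.
Local Notation ex P := (ex_below P N).
Local Notation "b1 &&& b2" := (if b1 then b2 else false) (at level 41, right associativity).

Definition has_bull := ex (fun a => ex (fun b => m a b &&& ex (fun c => m a c &&& m b c &&&
  ex (fun p => m p a &&& ~~ m p b &&& ~~ m p c &&&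
  ex (fun q => m q b &&& ~~ m q a &&& ~~ m q c &&& ~~ m p q))))).

Definition has_chair := ex (fun c => ex (fun a => m c a &&& ex (fun b => m c b &&& (a != b) &&& ~~ m a b &&&
  ex (fun d => m c d &&& ~~ m a d &&& ~~ m b d &&&
  ex (fun e => m d e &&& ~~ m e c &&& ~~ m e a &&& ~~ m e b))))).

Definition has_pentagon := ex (fun a => ex (fun b => m a b &&& ex (fun c => m b c &&& ~~ m a c &&&
  ex (fun d => m c d &&& ~~ m a d &&& ~~ m b d &&&
  ex (fun e => m d e &&& m e a &&& ~~ m b e &&& ~~ m c e))))).

Definition has_clique5 := ex (fun a => ex (fun b => m a b &&& ex (fun c => m a c &&& m b c &&&
  ex (fun d => m a d &&& m b d &&& m c d &&&
  ex (fun e => m a e &&& m b e &&& m c e &&& m d e))))).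

(* [s] lists the vertices of a C_5[2,2,2,2,1], clique by clique *)
Definition is_C5_22221 (s : seq nat) :=
  [&& size s == 9, uniq s, all (fun i => i < N) s &
  all (fun p => all (fun q => ((p != q) && ((p./2 == q./2) || (q./2 == p./2.+1 %% 5)))
    ==> m (nth 0 s p) (nth 0 s q)) (iota 0 9)) (iota 0 9)].

Definition not_tame := if has_bull then true else if has_chair then true else has_pentagon.

Variables (G : sgraph) (f : nat -> G).
Hypotheses (fm : forall i j, i < N -> j < N -> f i -- f j = m i j).
Hypothesis (fI : forall i j, i < N -> j < N -> f i = f j -> i = j).

Lemma exP (P : pred nat) : ex P -> exists2 i, i < N & P i.
Proof.
elim: N => //= k IHk; case: ifP => [Pk _|_ /IHk[i ik Pi]]; first by exists k.
by exists i; rewrite // ltnW.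
Qed.

Lemma not_tameF : tame G -> not_tame -> False.
Proof.
move=> [tb tc tp]; rewrite /not_tame; case: ifP => [+ _|_].
  case/exP => a aN /exP[b bN /andP[ab /exP[c cN /and3P[ac bc]]]].
  case/exP => p pN /and4P[pa pb pc /exP[q qN /and4P[qb qa qc pq]]].
  by apply: (tb (f a) (f b) (f c) (f p) (f q)); rewrite fm.
case: ifP => [+ _|_].
  case/exP => c cN /exP[a aN /andP[ca /exP[b bN /and4P[cb ab' ab]]]].
  case/exP => d dN /and4P[cd ad bd /exP[e eN /and4P[de ec ea eb]]].
  apply: (tc (f c) (f a) (f b) (f d) (f e)); rewrite ?fm //.
  by apply: contra ab' => /eqP/(fI aN bN)->.
case/exP => a aN /exP[b bN /andP[ab /exP[c cN /and3P[bc ac]]]].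
case/exP => d dN /and4P[cd ad bd /exP[e eN /and4P[de ea be ce]]].
by apply: (tp (f a) (f b) (f c) (f d) (f e)); rewrite fm.
Qed.

Lemma clique5_seq (a b c d e : G) : a -- b -> a -- c -> a -- d -> a -- e ->
  b -- c -> b -- d -> b -- e -> c -- d -> c -- e -> d -- e -> obstruction G.
Proof.
move=> ab ac ad ae bc bd be cd ce de.
apply: (@clique5_obstruction _ [set x in [:: a; b; c; d; e]]).
  apply/cliqueP => x y; rewrite !inE.
  by case/or4P => [/eqP->|/eqP->|/eqP->|/orP[]/eqP->];
    case/or4P => [/eqP->|/eqP->|/eqP->|/orP[]/eqP->]; rewrite ?eqxx // => _; adj.
rewrite cardsE; suff /card_uniqP -> : uniq [:: a; b; c; d; e] by [].
by rewrite /= !inE !negb_or !adj_neq.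
Qed.

Lemma has_clique5_obstruction : has_clique5 -> obstruction G.
Proof.
case/exP => a aN /exP[b bN /andP[ab /exP[c cN /and3P[ac bc]]]].
case/exP => d dN /and4P[ad bd cd /exP[e eN /and4P[ae be ce de]]].
by apply: (@clique5_seq (f a) (f b) (f c) (f d) (f e)); rewrite fm.
Qed.

Lemma C5_22221_obstruction s : is_C5_22221 s -> obstruction G.
Proof.
case/and4P => /eqP sz us /allP sN /allP sm.
do 3!right; exists 2, [:: 2; 2; 2; 2; 1]; split=> //; first by right.
set H := clique_expansion _.
pose pos (u : H) := 2 * val (tag u) + val (tagged u).
have sub (u : H) : val (tagged u) <= 1 /\ pos u < 9.
  rewrite /pos; case: u => [[i /= i5] j] /=.
  by have := ltn_ord j; case: i i5 j => [|[|[|[|[|]]]]] //= _ j; lia.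
have pI : injective pos.
  move=> u w E; have [u1 _] := sub u; have [w1 _] := sub w; move: E u1 w1; rewrite /pos.
  case: u w => [i x] [j y] /= E u1 w1.
  have ij : i = j by apply: val_inj => /=; lia.
  by subst j; congr existT; apply: val_inj => /=; lia.
have half (u : H) : (pos u)./2 = val (tag u) by have [] := sub u; rewrite /pos; lia.
have sN' u : nth 0 s (pos u) < N by apply/sN/mem_nth; rewrite sz; case: (sub u).
exists (fun u : H => f (nth 0 s (pos u))); split.
  move=> u w /(fI (sN' u) (sN' w))/eqP; rewrite nth_uniq ?sz //; try by case: (sub u); case: (sub w).
  by move/eqP/pI.
have E (u w : H) : u != w -> (tag u == tag w) || (tag w == ordS (tag u)) ->
    f (nth 0 s (pos u)) -- f (nth 0 s (pos w)).
  move=> nuw H'; rewrite fm ?sN' //.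
  have pu : pos u \in iota 0 9 by rewrite mem_iota; case: (sub u).
  have pw : pos w \in iota 0 9 by rewrite mem_iota; case: (sub w).
  have /implyP := allP (sm _ pu) _ pw; apply; rewrite (inj_eq pI) nuw !half.
  by case/orP: H' => /eqP->; rewrite ?eqxx //= ?eqxx orbT.
move=> u w /andP[nuw /orP[|H']]; first exact: E.
by rewrite sadj_sym; apply: E; rewrite // eq_sym.
Qed.

End MatrixPatterns.

(* A 7-antihole [0, ..., 6] and two more vertices [7] and [8], which see the
   antihole according to [bv] and [bw]. *)
Definition ext_mat (bv bw : seq bool) (e : bool) : rel nat := fun i j =>
  if i < 7 then
    if j < 7 then (i != j) && (j != i.+1 %% 7) && (i != j.+1 %% 7)
    else if j == 7 then nth false bv i else nth false bw i
  else if i == 7 then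
    if j < 7 then nth false bv j else (j == 8) && e
  else if j < 7 then nth false bw j else (j == 7) && e.

Fixpoint bitseqs n : seq (seq bool) :=
  if n is n'.+1 then map (cons true) (bitseqs n') ++ map (cons false) (bitseqs n') else [:: [::]].

Lemma mem_bitseqs s : s \in bitseqs (size s).
Proof.
elim: s => //= b s IHs; rewrite mem_cat; case: b; rewrite map_f ?orbT //.
Qed.

Definition missing1 i : seq bool := mkseq (fun j => j != i) 7.
Definition missing2 i : seq bool := mkseq (fun j => (j != i) && (j != (i + 2) %% 7)) 7.
(** The ways of seeing the antihole only in part that [one_vertex_check] leaves among the 128
    conceivable ones. *)
Definition mixed_types := map missing1 (iota 0 7) ++ map missing2 (iota 0 7).

Lemma one_vertex_check : all (fun bv => if not_tame (ext_mat bv [::] false) 8 then true else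
  [|| bv == nseq 7 true, bv == nseq 7 false | bv \in mixed_types]) (bitseqs 7).
Proof. by vm_compute. Qed.

(** In steps of two, [x 2, x 4, x 6, x 1, x 3, x 5, x 0], the antihole is the square of a 7-cycle.
    Inserting [w] after [x 2] and [v] after [x 1] gives nine vertices in cyclic order, which are
    grouped in pairs with [x 0] left over. *)
Definition C5_layout v w i :=
  let x k := (k + i) %% 7 in [:: x 2; w; x 4; x 6; x 1; v; x 3; x 5; x 0].

(** Non-adjacent vertices of equal type are let through, as the coloring in [antihole_case] gives
    them a common color. *)
Definition two_vertex_ok bv bw e := let m := ext_mat bv bw e in
  if ~~ e && (bv == bw) then true else if has_clique5 m 9 then true else if not_tame m 9 then true
  else ex_below (fun i => is_C5_22221 m 9 (C5_layout 7 8 i) || is_C5_22221 m 9 (C5_layout 8 7 i)) 7.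

Lemma two_vertex_check : all (fun bv => all (fun bw =>
  two_vertex_ok bv bw true && two_vertex_ok bv bw false) mixed_types) mixed_types.
Proof. by vm_compute. Qed.

Lemma far_vertex_check :
  all (fun bw => not_tame (ext_mat (nseq 7 false) bw true) 9) mixed_types.
Proof. by vm_compute. Qed.

(** * Graphs with a 7-antihole *)

Section AntiholeCase.
Variables (G : sgraph) (h : nat -> G).
Hypotheses (tG : tame G) (hh : hole (@coadj G) 7 h).
Hypothesis crit : forall A : {set G}, A != setT -> colset A 4.

Let core : {set G} := [set v | has (fun i => v == h i) (iota 0 7)].

Lemma coreP v : reflect (exists2 i, i < 7 & v = h i) (v \in core).
Proof.
rewrite inE; apply: (iffP hasP) => [[i]|[i i7 ->]].
  by rewrite mem_iota => /andP[_ i7] /eqP->; exists i.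
by exists i; rewrite ?mem_iota.
Qed.

Lemma antihole_mod i : h (i %% 7) = h i.
Proof. by apply: periodic_mod; case: hh. Qed.

Lemma antihole_core i : h i \in core.
Proof. by apply/coreP; exists (i %% 7); rewrite ?ltn_pmod ?antihole_mod. Qed.

Lemma antihole_eq i j : i < 7 -> j < 7 -> (h i == h j) = (i == j).
Proof.
have [_ hI _] := hh; wlog ij : i j / i <= j.
  move=> W i7 j7; have [ij|ij] := leqP i j; first exact: W.
  by rewrite eq_sym [RHS]eq_sym; apply: W => //; apply: ltnW.
by move=> i7 j7; rewrite -{1}(subnKC ij) hI; lia.
Qed.

Lemma antihole_adj i j : i < 7 -> j < 7 ->
  h i -- h j = (i != j) && (j != i.+1 %% 7) && (i != j.+1 %% 7).
Proof.
have [_ hI hA] := hh; wlog ij : i j / i <= j.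
  move=> W i7 j7; have [ij|ij] := leqP i j; first exact: W.
  rewrite sadj_sym W // 1?ltnW // eq_sym -!andbA; congr (_ && _); exact: andbC.
move=> i7 j7; have := hA i (j - i); rewrite subnKC // /coadj antihole_eq // => /(_ ltac:(lia)).
have [->|nij] := eqVneq i j; first by rewrite sadj_irr.
by move=> /= H; rewrite -[LHS]negbK H; lia.
Qed.

Definition bits v := [seq v -- h i | i <- iota 0 7].
Definition layout v w i := if i < 7 then h i else if i == 7 then v else w.

Lemma nth_bits v i : i < 7 -> nth false (bits v) i = v -- h i.
Proof. by move=> i7; rewrite (nth_map 0) ?size_iota // nth_iota. Qed.

Lemma layout_mat v w i j : i < 9 -> j < 9 ->
  layout v w i -- layout v w j = ext_mat (bits v) (bits w) (v -- w) i j.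
Proof.
move=> i9 j9; rewrite /layout /ext_mat.
case: (ltnP i 7) => i7; case: (ltnP j 7) => j7.
- exact: antihole_adj.
- by case: ifP => _; rewrite nth_bits // sadj_sym.
- by case: ifP => _; rewrite nth_bits.
have [-> | ->] : i = 7 \/ i = 8 by lia.
  have [-> | ->] : j = 7 \/ j = 8 by lia.
    by rewrite /= sadj_irr.
  by [].
have [-> | ->] : j = 7 \/ j = 8 by lia.
  by rewrite /= sadj_sym.
by rewrite /= sadj_irr.
Qed.

Lemma layout_inj v w i j : v \notin core -> w \notin core -> v != w ->
  i < 9 -> j < 9 -> layout v w i = layout v w j -> i = j.
Proof.
move=> vC wC vw i9 j9; rewrite /layout.
have nv k : v <> h k by move=> E; rewrite E antihole_core in vC.
have nw k : w <> h k by move=> E; rewrite E antihole_core in wC.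
case: (ltnP i 7) => i7; case: (ltnP j 7) => j7.
- by move=> /eqP; rewrite antihole_eq // => /eqP.
- by case: ifP => _ /esym; [move/nv | move/nw].
- by case: ifP => _; [move/nv | move/nw].
case: eqP => i_7; case: eqP => j_7; try lia.
- by move=> E; rewrite E eqxx in vw.
- by move=> E; rewrite E eqxx in vw.
Qed.

Lemma layout_inj8 v w i j : v \notin core ->
  i < 8 -> j < 8 -> layout v w i = layout v w j -> i = j.
Proof.
move=> vC i8 j8; rewrite /layout.
have nv k : v <> h k by move=> E; rewrite E antihole_core in vC.
case: (ltnP i 7) => i7; case: (ltnP j 7) => j7.
- by move=> /eqP; rewrite antihole_eq // => /eqP.
- by have -> : j = 7; [lia | move=> /esym/nv].
- by have -> : i = 7; [lia | move=> /nv].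
- by lia.
Qed.

Lemma bits_types v : v \notin core ->
  [\/ bits v = nseq 7 true, bits v = nseq 7 false | bits v \in mixed_types].
Proof.
move=> vC; have := allP one_vertex_check (bits v) (mem_bitseqs (bits v)).
case: ifP => [nt _|_].
  (* Only the first eight indices are read, so the second outside vertex is a dummy. *)
  case: (not_tameF (f := layout v v) _ _ tG nt) => [i j i8 j8|i j]; last exact: layout_inj8.
  rewrite layout_mat; [|lia|lia]; rewrite /ext_mat.
  case: (ltnP i 7) => i7; case: (ltnP j 7) => j7 //.
  - by have -> : j = 7 by lia.
  - by have -> : i = 7 by lia.
  - by have [-> ->] : i = 7 /\ j = 7 by lia.
by case/or3P => [/eqP|/eqP|]; [constructor 1|constructor 2|constructor 3].
Qed.

Lemma bits_nseq v b i : bits v = nseq 7 b -> v -- h i = b.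
Proof.
move=> E; have i7 : i %% 7 < 7 by rewrite ltn_pmod.
by rewrite -antihole_mod -nth_bits // E nth_nseq i7.
Qed.

Lemma two_outside v w : v \notin core -> w \notin core -> v != w ->
  bits v \in mixed_types -> bits w \in mixed_types ->
  obstruction G \/ (~~ v -- w /\ bits v = bits w).
Proof.
move=> vC wC vw tv tw.
have fm i j : i < 9 -> j < 9 -> layout v w i -- layout v w j = ext_mat (bits v) (bits w) (v -- w) i j.
  exact: layout_mat.
have fI i j : i < 9 -> j < 9 -> layout v w i = layout v w j -> i = j by apply: layout_inj.
have : two_vertex_ok (bits v) (bits w) (v -- w).
  by have /andP[] := allP (allP two_vertex_check _ tv) _ tw; case: (v -- w).
rewrite /two_vertex_ok; case: ifP => [/andP[nvw /eqP E] _|_]; first by right.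
case: ifP => [c5 _|_]; first by left; apply: has_clique5_obstruction fm c5.
case: ifP => [nt _|_]; first by case: (not_tameF fm fI tG nt).
by case/exP => i _ /orP[] H; left; apply: C5_22221_obstruction fm fI _ H.
Qed.

Lemma antihole_case : obstruction G \/ colset [set: G] 4.
Proof.
have h_neq v i : v \notin core -> v != h i by apply: contraNneq => ->; apply: antihole_core.
have [[b [bC bT]]|noT] := classic (exists b, b \notin core /\ bits b = nseq 7 true).
  left; left; apply: (@contains_join _ _ _ (fun i : compl (cycle_graph 7) => h i)) (embedding_vertex b) _.
    apply: embedding_graph_of => [x y /eqP|x y nxy nadj].
      by rewrite antihole_eq // => /eqP/val_inj.
    rewrite antihole_adj // -andbA; apply/and3P; split=> //.
      by apply: contra nadj => E; rewrite /= /symm_loopless nxy -val_eqE /= E.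
    by apply: contra nadj => E; rewrite /= /symm_loopless nxy orbC -val_eqE /= E.
  by move=> x _; rewrite sadj_sym (bits_nseq _ bT).
pose Z := [set z | (z \notin core) && (bits z == nseq 7 false)].
have types v : v \notin core -> v \notin Z -> bits v \in mixed_types.
  move=> vC; rewrite inE vC /= => /eqP vZ; case: (bits_types vC) => // E.
  by case: noT; exists v.
have [[z zZ]|noZ] := classic (exists z, z \in Z).
  (* No edge leaves [Z]: its members miss the antihole, and [far_vertex_check] excludes neighbours
     of mixed type. Both parts are proper, hence 4-colorable. *)
  right; rewrite -(setUCr Z); apply: colset_union; last first.
  - by apply: crit; apply: (@proper_notin _ _ z); rewrite in_setC zZ.
  - by apply: crit; apply: (@proper_notin _ _ (h 0)); rewrite inE antihole_core.
  move=> x y; rewrite inE => /andP[xC /eqP xF]; rewrite in_setC => yZ.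
  have [/coreP[i _ ->]|yC] := boolP (y \in core); first by rewrite (bits_nseq _ xF).
  apply/negP => xy.
  have := allP far_vertex_check _ (types y yC yZ); rewrite -xF -[in X in ext_mat _ _ X]xy => nt.
  apply: (not_tameF (f := layout x y) _ _ tG nt) => i j; first exact: layout_mat.
  by apply: layout_inj => //; apply: adj_neq.
have {}types v : v \notin core -> bits v \in mixed_types.
  by move=> vC; apply: types => //; apply/negP => vZ; apply: noZ; exists v.
have [|nobs] := classic (obstruction G); [by left | right].
have out v w : v \notin core -> w \notin core -> ~~ v -- w /\ bits v = bits w.
  move=> vC wC; have [->|vw] := eqVneq v w; first by rewrite sadj_irr.
  by case: (two_outside vC wC vw (types _ vC) (types _ wC)).
(* All outside vertices have the same type, and not the full one, so they miss a common vertex of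
   the antihole. *)
have [j jout] : exists j, forall v, v \notin core -> ~~ v -- h j.
  have [[v vC]|nov] := classic (exists v, v \notin core); last first.
    by exists 0 => v vC; case: nov; exists v.
  have [j j7 vj] : exists2 j, j < 7 & ~~ v -- h j.
    apply: NNPP => nj; apply: noT; exists v; split=> //.
    apply: (@eq_from_nth _ false); rewrite /bits size_map size_iota // => i i7.
    rewrite nth_bits // nth_nseq i7; apply: contraT => vi; case: nj.
    by exists i; rewrite // -[_ -- _]/(_ -- _); case: (v -- h i) vi.
  exists j => w wC; have [_ E] := out v w vC wC.
  by rewrite -(nth_bits w j7) -E nth_bits.
(* Counted from [h j], the antihole splits into [h j] and three consecutive, hence non-adjacent,
   pairs. Color 0 of [h j] is also the default for the vertices outside. *)
pose k v := if [pick i : 'I_7 | v == h (j + i)] is Some i then (val i).+1./2 else 0.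
have kP v : v \in core -> exists2 i, i < 7 & v = h (j + i) /\ k v = i.+1./2.
  case/coreP => i i7 E; rewrite /k; case: pickP => [l /eqP El|].
    by exists l.
  have l7 : (i + 7 - j %% 7) %% 7 < 7 by rewrite ltn_pmod.
  move/(_ (Ordinal l7)); rewrite /= E -(antihole_mod (j + _)) modnDmr => /eqP[].
  congr h; rewrite -modnDml; have := ltn_pmod j (isT : 0 < 7); move: (j %% 7) => j' j'7.
  by have -> : j' + (i + 7 - j') = i + 7; [lia | rewrite modnDr modn_small].
have k0 v : v \notin core -> k v = 0.
  by move=> vC; rewrite /k; case: pickP => // i; rewrite (negbTE (h_neq _ _ vC)).
exists k; split=> [v _|u v _ _ uv E].
  by have [/kP[i i7 [_ ->]]|/k0->//] := boolP (v \in core); lia.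
have [hp hI hA] := hh.
have zero w i : w \notin core -> i < 7 -> i.+1./2 = 0 -> ~~ w -- h (j + i).
  by move=> wC i7 i0; have -> : i = 0; [lia | rewrite addn0; apply: jout].
have near a b : a <= b -> b < 7 -> a.+1./2 = b.+1./2 -> ~~ h (j + a) -- h (j + b).
  move=> ab b7 E'; have [->|nab] := eqVneq a b; first by rewrite sadj_irr.
  have := hA (j + a) 1 isT; rewrite /= /coadj; have -> : j + a + 1 = j + b by lia.
  by case/andP.
move: uv E; have [/kP[i i7 [-> ->]]|uC] := boolP (u \in core);
  have [/kP[l l7 [-> ->]]|vC] := boolP (v \in core).
- move=> uv E; have [il|li] := leqP i l; first by have := near i l il l7 E; rewrite uv.
  by have := near l i (ltnW li) i7 (esym E); rewrite sadj_sym uv.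
- by rewrite (k0 v) // => uv E; have := zero v i vC i7 E; rewrite sadj_sym uv.
- by rewrite (k0 u) // => uv E; have := zero u l uC l7 (esym E); rewrite uv.
- by have [+ _] := out u v uC vC => /negbTE->.
Qed.

End AntiholeCase.

(** * Longer antiholes and the conclusion *)

Lemma antihole_lt (G : sgraph) n (h : nat -> G) i j : hole (@coadj G) n h ->
  i < j -> j - i < n -> h i -- h j = (j - i != 1) && (j - i != n.-1).
Proof.
move=> [_ hI hA] ij ji; have := hA i _ ji; rewrite /coadj hI // (subnKC (ltnW ij)).
by case: (h i -- h j); lia.
Qed.

(** In steps of two the antihole contains the cube of a 9-cycle: differences 2, 4 and 6 are adjacent
    modulo 9. Two consecutive cliques of the expansion span at most four successive vertices of this
    order. *)
Lemma antihole9_obstruction (G : sgraph) (h : nat -> G) :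
  hole (@coadj G) 9 h -> obstruction G.
Proof.
move=> hh; pose m i j := (i != j) && (j != i.+1 %% 9) && (i != j.+1 %% 9).
have lt i j : i < j -> j < 9 -> h i -- h j = m i j /\ h i <> h j.
  move=> ij j9; split; first by rewrite (antihole_lt hh) /m; lia.
  by have [_ hI _] := hh; have := hI i (j - i); rewrite (subnKC (ltnW ij)) => H /eqP; rewrite H; lia.
have fm i j : i < 9 -> j < 9 -> h i -- h j = m i j.
  move=> i9 j9; have [ij|ji|->] := ltngtP i j.
  - by have [] := lt i j.
  - by rewrite sadj_sym; have [-> _] := lt j i ji i9; rewrite /m; lia.
  - by rewrite sadj_irr /m eqxx.
have fI i j : i < 9 -> j < 9 -> h i = h j -> i = j.
  move=> i9 j9 E; have [ij|ji|//] := ltngtP i j; first by have [_ []] := lt i j ij j9.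
  by have [_ []] := lt j i ji i9.
apply: (C5_22221_obstruction fm fI (s := [:: 2; 4; 6; 8; 1; 3; 5; 7; 0])).
by vm_compute.
Qed.

(** The differences of the chosen indices are even and at most 8, so none is 1 or [n.-1]; for length
    9, [h 0] and [h 8] would be consecutive. *)
Lemma long_antihole_obstruction (G : sgraph) n (h : nat -> G) :
  10 < n -> hole (@coadj G) n h -> obstruction G.
Proof.
move=> n10 hh.
by apply: (@clique5_seq _ (h 0) (h 2) (h 4) (h 6) (h 8)); rewrite (antihole_lt hh) //; lia.
Qed.

Lemma obstruction_induced (G : sgraph) (A : {set G}) : obstruction (induced A) -> obstruction G.
Proof.
have mono H : contains (induced A) H -> contains G H.
  move=> [f [fI fH]]; exists (fun x => val (f x)); split=> [x y /val_inj/fI //|x y xy].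
  exact: fH.
move=> [H|[[i [i1 H]]|[[i [i1 H]]|[i [ks [i1 sz pat H]]]]]].
- by left; apply: mono.
- by right; left; exists i; split=> //; apply: mono.
- by right; right; left; exists i; split=> //; apply: mono.
- by right; right; right; exists i, ks; split=> //; apply: mono.
Qed.

(** A proper vertex set that is not 4-colorable yields an obstruction by induction, so [G] may be
    taken as critical. Perfection then applies with [q = 4] because a fifth clique vertex is itself
    an obstruction. *)
Lemma obstruction_or_colset (G : sgraph) : tame G -> obstruction G \/ colset [set: G] 4.
Proof.
have [k] := ubnP #|G|; elim: k G => // k IHk G Gk tG.
have [crit|ncrit] := classic (forall A : {set G}, A != setT -> colset A 4); last first.
  have [A [AT nA]] : exists A : {set G}, A != setT /\ ~ colset A 4.
    by apply: NNPP => nA; apply: ncrit => A AT; apply: NNPP => cA; apply: nA; exists A.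
  have Ak : #|induced A| < k.
    have -> : #|induced A| = #|A| by rewrite card_sig.
    apply: leq_trans (_ : #|A|.+1 <= #|G|) _; last by rewrite -ltnS.
    by rewrite -cardsT; apply: proper_card; rewrite properT.
  case: (IHk _ Ak (tame_induced A tG)) => [/obstruction_induced|[c [c1 c2]]]; first by left.
  by case: nA; apply/colset_induced; exists c; split=> [x|x y]; [apply: c1|apply: c2]; rewrite inE.
have [[n [h [on n6 hh]]]|nohole] := classic (exists n h, [/\ odd n, 6 < n & hole (@sadj G) n h]).
  have En : n = 2 * n./2 + 1 by lia.
  by move: n6 hh; rewrite En => n6 hh; apply: odd_hole_case tG n6 hh crit.
have [[n [h [on n6 hh]]]|noanti] := classic (exists n h, [/\ odd n, 6 < n & hole (@coadj G) n h]).
  have [n10|n10] := ltnP 10 n; first by left; apply: long_antihole_obstruction hh.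
  have [E|E] : n = 7 \/ n = 9 by lia.
    by subst n; apply: antihole_case tG hh crit.
  by subst n; left; apply: antihole9_obstruction hh.
have bG : berge G.
  by split=> // n h on n6 hh; [apply: nohole|apply: noanti]; exists n, h.
have [[K [cK K4]]|noK] := classic (exists K : {set G}, clique K /\ 4 < #|K|).
  by left; apply: clique5_obstruction cK K4.
right; apply: berge_perfect bG _ _ => K _ cK.
by rewrite leqNgt; apply/negP => K4; apply: noK; exists K.
Qed.

Lemma induced_of_nat (G : sgraph) n (r : rel 'I_n) (f : nat -> G) :
  (forall i j : 'I_n, i < j -> f i != f j /\ f i -- f j = r i j || r j i) ->
  contains_induced G (graph_of r).
Proof.
move=> H; exists (fun i : 'I_n => f i); split=> [x y E|x y].
  apply: val_inj; have [xy|yx|//] := ltngtP x y.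
    by have [] := H _ _ xy; rewrite E eqxx.
  by have [] := H _ _ yx; rewrite E eqxx.
have [xy|yx|/val_inj->] := ltngtP x y; last by rewrite !sadj_irr.
  by have [_ ->] := H _ _ xy; rewrite /= /symm_loopless -val_eqE neq_ltn xy.
by rewrite sadj_sym; have [_ ->] := H _ _ yx; rewrite /= /symm_loopless orbC -val_eqE neq_ltn yx orbT.
Qed.

Ltac five_vertices :=
  let i := fresh in let j := fresh in
  move=> [i +] [j +]; case: i => [|[|[|[|[|i]]]]] //= ?; case: j => [|[|[|[|[|j]]]]] //= ? _;
  (split; [ first [by adj | by apply: adj_neq; adj]
         | match goal with |- ?u -- ?v = _ => first
           [ by have -> : u -- v by adj | by have /negbTE-> : ~~ u -- v by adj ] end ]).

Lemma tame_of_induced (G : sgraph) : ~ contains_induced G bull -> ~ contains_induced G chair ->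
  ~ contains_induced G (cycle_graph 5) -> tame G.
Proof.
move=> nb nc np; split.
- move=> a b c p q ab ac bc pa qb pb pc qa qc pq; apply: nb.
  have ? : c != p by apply: (@neq_adj _ _ _ b); adj.
  have ? : b != p by apply: (@neq_adj _ _ _ c); adj.
  have ? : q != p by apply: (@neq_adj _ _ _ b); adj.
  have ? : a != q by apply: (@neq_adj _ _ _ c); adj.
  have ? : c != q by apply: (@neq_adj _ _ _ a); adj.
  apply: (@induced_of_nat _ _ _ (nth p [:: p; a; c; b; q])); five_vertices.
- move=> c a b d e ca cb cd de nab ab ad bd ec ea eb; apply: nc.
  have ? : c != e by apply: (@neq_adj _ _ _ a); adj.
  have ? : d != a by apply: (@neq_adj _ _ _ e); adj.
  have ? : d != b by apply: (@neq_adj _ _ _ e); adj.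
  have ? : a != e by apply: (@neq_adj _ _ _ c); adj.
  have ? : b != e by apply: (@neq_adj _ _ _ c); adj.
  apply: (@induced_of_nat _ _ _ (nth c [:: c; a; b; d; e])); five_vertices.
- move=> a b c d e ab bc cd de ea ac ad bd be ce; apply: np.
  have ? : a != c by apply: (@neq_adj _ _ _ e); adj.
  have ? : a != d by apply: (@neq_adj _ _ _ b); adj.
  have ? : b != d by apply: (@neq_adj _ _ _ a); adj.
  have ? : b != e by apply: (@neq_adj _ _ _ c); adj.
  have ? : c != e by apply: (@neq_adj _ _ _ b); adj.
  apply: (@induced_of_nat _ _ _ (nth a [:: a; b; c; d; e])); five_vertices.
Qed.

Theorem theorem1p7 (G : sgraph) :
  connected G ->
  ~ contains_induced G bull ->
  ~ contains_induced G chair ->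
  ~ contains_induced G (cycle_graph 5) ->
  contains G (join (compl (cycle_graph 7)) (complete 1)) \/
  (exists i : nat, 1 <= i /\
     contains G (join (cycle_graph (2 * i + 1)) (complete 2))) \/
  (exists i : nat, 1 <= i /\
     contains G (join (spindle i) (complete 1))) \/
  (exists (i : nat) (ks : seq nat),
     [/\ 1 <= i, size ks = 2 * i + 1,
         twos_then_alternating ks \/ twos_then_one i ks
       & contains G (clique_expansion ks)]) \/
  colorable 4 G.
Proof.
move=> _ nb nc np; have [|[c [c1 c2]]] := obstruction_or_colset (tame_of_induced nb nc np).
  by case=> [|[|[|]]]; auto.
do 4!right; have clt x : c x < 4 by apply: c1; rewrite inE.
exists (fun x => Ordinal (clt x)) => x y xy; apply/negP => /eqP[].
by apply: c2; rewrite ?inE.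
Qed.
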